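(* Let $J=\{i_1,\dots,i_r\}\subseteq I_n=\{1,\dots,n\}$ have $r$ elements, let $0\le s\le r/2$ be an integer, let $x_p$ be a non-zero scalar multiple of $T_{0,E_{i_{2p-1}i_{2p}}}$ for $p=1,\dots,s$, let $c_{2s+1},\dots,c_r\in\mathbb C^\times$, and put $$x=\sum_{p=1}^s x_p+\sum_{j=2s+1}^r c_jH_{i_j}\in(\mathfrak q_n)^{ss}_{\bar1},$$ an element of rank $r/2$. Then: (i) $DS_x(\mathfrak q_n)$ can be identified with $\mathfrak q(I_n\setminus J)\cong\mathfrak q_{n-r}$. (ii) $DS_x$ maps the standard $\mathfrak q_n$-module $L(\varepsilon_1)$ to the standard $\mathfrak q_{n-r}$-module. (iii) If $r<n$, then $DS_x(\mathfrak{sq}_n)$, $DS_x(\mathfrak{pq}_n)$, $DS_x(\mathfrak{psq}_n)$ can be identified with $\mathfrak{sq}(I_n\setminus J)$, $\mathfrak{pq}(I_n\setminus J)$, $\mathfrak{psq}(I_n\setminus J)$ respectively. (iv) If $r=n$, then $DS_x(\mathfrak{sq}_n)\cong\mathbb C$ and $DS_x(\mathfrak{pq}_n)\cong\Pi\mathbb C$. (v) If $r=n>1$, then $DS_x(\mathfrak{psq}_n)$ is a commutative $(1|1)$-dimensional Lie superalgebra if $x=x_{nil}$ (i.e. $x=\sum_p x_p$) or if $\sum c_i^{-1}=\sum c_i^{-3}=0$; $DS_x(\mathfrak{psq}_n)\cong\mathfrak q_1$ if $\sum c_i^{-1}=0\ne\sum c_i^{-3}$; and $DS_x(\mathfrak{psq}_n)=0$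 if $\sum c_i^{-1}\ne0$ (sums over $i=2s+1,\dots,n$).
   Context: Ground field $\mathbb C$; $\Pi$ = parity change. $\mathfrak q_n\subset\mathfrak{gl}(n|n)$ is the Lie superalgebra of matrices $T_{A,B}=\begin{pmatrix}A&B\\ B&A\end{pmatrix}$, with $T_{A,0}$ even and $T_{0,B}$ odd; $\mathfrak q_0=0$. $H_i=T_{0,E_{ii}}$. $\mathfrak{sq}_n=\{T_{A,B}:\mathrm{tr}\,B=0\}$, $\mathfrak{pq}_n=\mathfrak q_n/\mathbb C T_{\mathrm{Id},0}$, $\mathfrak{psq}_n=\mathfrak{sq}_n/\mathbb CT_{\mathrm{Id},0}$; each is a $\mathfrak q_n$-module via the adjoint action. The standard module is the natural $(n|n)$-dimensional module (up to parity change). For $K\subseteq I_n$, $\mathfrak q(K)\cong\mathfrak q_{|K|}$ is the subalgebra of $\mathfrak q_n$ spanned by $T_{E_{ij},0},T_{0,E_{ij}}$ with $i,j\in K$, and $\mathfrak{sq}(K),\mathfrak{pq}(K),\mathfrak{psq}(K)$ are the corresponding analogues. $\mathfrak g_{\bar1}^{ss}=\{x\in\mathfrak g_{\bar1}:\mathrm{ad}[x,x]\text{ semisimple}\}$. For $x=T_{0,B}\in(\mathfrak q_n)_{\bar1}^{ss}$ with Jordan–Chevalley decomposition $B=B_{ss}+B_{nil}$, $\mathrm{rank}\,x=\mathrm{rank}\,B_{nil}+\frac12\mathrm{rank}\,B_{ss}$ and $x_{nil}=T_{0,B_{nil}}$. Put $x^2=\frac12[x,x]$. For a module $M$ on which $x^2$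 acts semisimply, $M^{x^2}=\ker_Mx^2$ and $DS_x(M)=\ker(x|_{M^{x^2}})/\mathrm{im}(x|_{M^{x^2}})$. If $M$ is a Lie superalgebra on which $x$ acts by derivations, then $DS_x(M)$ is a Lie superalgebra. $DS_x(\mathfrak g)$ ''can be identified with'' a subalgebra $\mathfrak k$ means that $\mathfrak g^x=\mathfrak k\ltimes([x,\mathfrak g]\cap\mathfrak g^x)$, where $\mathfrak g^x$ is the kernel of the action of $x$ on $\mathfrak g$, so that $\mathfrak k$ maps isomorphically onto $DS_x(\mathfrak g)$.
   Formalization: In (iii), for pq and psq ''can be identified with'' means that q(K)→pq_n, resp. sq(K)→psq_n, with K=I_n∖J, induces a Lie superalgebra isomorphism of pq(K), psq(K) onto DS_x; the semidirect form is false (pq_2, x=H_2). Also n≥1, since (iv) fails for n=0. *)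

(* Defs.v *)
From HB Require Import structures.
From mathcomp Require Import all_boot all_order all_algebra.
From mathcomp Require Import ring.

Set Implicit Arguments.
Unset Strict Implicit.
Unset Printing Implicit Defensive.

Import GRing.Theory Num.Theory.
Local Open Scope ring_scope.

(* The ground field is an arbitrary [numClosedFieldType]; the case of interest is
   the field of complex numbers. *)

(* Parities are booleans: [false] is even, [true] is odd. *)
Record superSpace (F : numClosedFieldType) := SuperSpace {
  ss_sort :> vectType F;
  par : bool -> {vspace ss_sort};
  par_full : (par false + par true)%VS = fullv;
  par_direct : (par false :&: par true)%VS = 0%VS
}.
Arguments par {F s} _ : rename.

Record lieSuper (F : numClosedFieldType) := LieSuper {
  ls_space :> superSpace F;
  br : ls_space -> ls_space -> ls_space;
  br_linl : forall y, linear (br^~ y);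
  br_linr : forall x, linear (br x);
  br_par : forall a b x y,
    x \in par a -> y \in par b -> br x y \in par (a (+) b);
  br_anti : forall a b x y, x \in par a -> y \in par b ->
    br x y = - ((-1) ^+ (a && b) *: br y x);
  br_jacobi : forall a b x y z, x \in par a -> y \in par b ->
    br x (br y z) = br (br x y) z + (-1) ^+ (a && b) *: br y (br x z)
}.
Arguments br {F l} _ _ : rename.

Definition is_rep (F : numClosedFieldType) (g : lieSuper F) (M : superSpace F)
    (act : g -> M -> M) : Prop :=
  [/\ forall m, linear (act^~ m),
      forall x, linear (act x),
      forall a b x m, x \in par a -> m \in par b -> act x m \in par (a (+) b)
    & forall a b x y m, x \in par a -> y \in par b ->
        act (br x y) m
        = act x (act y m) - (-1) ^+ (a && b) *: act y (act x m)].

Record superMod (F : numClosedFieldType) (g : lieSuper F) := SuperMod {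
  sm_space :> superSpace F;
  act : g -> sm_space -> sm_space;
  act_rep : is_rep act
}.
Arguments act {F g s} _ _ : rename.

(* Lie superalgebras on which [g] acts by (super)derivations. *)
Record derAlg (F : numClosedFieldType) (g : lieSuper F) := DerAlg {
  da_lie :> lieSuper F;
  da_act : g -> da_lie -> da_lie;
  da_rep : is_rep da_act;
  da_der : forall a b x u v, x \in par a -> u \in par b ->
    da_act x (br u v)
    = br (da_act x u) v + (-1) ^+ (a && b) *: br u (da_act x v)
}.

Coercion da_mod (F : numClosedFieldType) (g : lieSuper F) (A : derAlg g) :
  superMod g := SuperMod (@da_rep F g A).

Section Basics.
Variable F : numClosedFieldType.

Definition odd_part (g : lieSuper F) := subvs_of (par true : {vspace g}).

Definition graded (V : superSpace F) (U : {vspace V}) : Prop :=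
  (U <= (U :&: par false) + (U :&: par true))%VS.

Definition subalgebra (g : lieSuper F) (U : {vspace g}) : Prop :=
  graded U /\ forall u v, u \in U -> v \in U -> br u v \in U.

(* [I] is a graded two-sided ideal of [U]. *)
Definition ideal_in (g : lieSuper F) (U I : {vspace g}) : Prop :=
  [/\ graded I, (I <= U)%VS
    & forall u v, u \in U -> v \in I -> br u v \in I /\ br v u \in I].

Definition lie_hom (g h : lieSuper F) (f : 'Hom(g, h)) : Prop :=
  (forall a x, x \in par a -> f x \in par a)
  /\ forall x y, f (br x y) = br (f x) (f y).

Definition lie_iso (g h : lieSuper F) (f : 'Hom(g, h)) : Prop :=
  lie_hom f /\ bijective f.

Definition lie_isomorphic (g h : lieSuper F) : Prop :=
  exists f : 'Hom(g, h), lie_iso f.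

Definition commutative_lie (g : lieSuper F) : Prop :=
  forall x y : g, br x y = 0.

Definition has_sdim (V : superSpace F) (p q : nat) : Prop :=
  \dim (par false : {vspace V}) = p /\ \dim (par true : {vspace V}) = q.

Definition lsemisimple (V : vectType F) (f : 'End(V)) : Prop :=
  exists2 e : seq V, basis_of fullv e
    & forall v, v \in e -> exists a : F, f v = a *: v.

End Basics.

(* The quotient [U / I] of graded subspaces [I <= U] of [V] is realised on a
   graded complement of [I] in [U]; [qproj U I] is the quotient map (it is only
   meaningful on [U]): it is onto, and on [U] its kernel is [I]
   (see [qproj_onto] and [qproj_eq0]). *)
Section Quotient.
Variables (F : numClosedFieldType) (V : superSpace F).
Implicit Types U I : {vspace V}.

Definition gcompl U I : {vspace V} :=
  (((U :&: par false) :\: I) + ((U :&: par true) :\: I))%VS.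

Definition quo U I : vectType F := subvs_of (gcompl U I).

Definition qproj U I : 'Hom(V, quo U I) :=
  (linfun (vsproj (gcompl U I)) \o daddv_pi (gcompl U I) I)%VF.

Definition qpar U I (b : bool) : {vspace quo U I} :=
  (linfun (vsval : quo U I -> V) @^-1: par b)%VS.

Lemma par_split (v : V) :
  exists v0 v1, [/\ v0 \in par false, v1 \in par true & v = v0 + v1].
Proof.
have: v \in (par false + par true)%VS by rewrite par_full memvf.
by case/memv_addP=> v0 h0 [v1 h1 ->]; exists v0, v1.
Qed.

Lemma par_disj (v : V) b : v \in par b -> v \in par (~~ b) -> v = 0.
Proof.
move=> h h'; apply/eqP; rewrite -memv0 -(par_direct V) memv_cap.
by case: b h h' => -> ->.
Qed.

Lemma graded_split U v : graded U -> v \in U ->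
  exists v0 v1, [/\ v0 \in U, v0 \in par false, v1 \in U, v1 \in par true
    & v = v0 + v1].
Proof.
move=> gU Uv; have /memv_addP[v0 /memv_capP[U0 h0] [v1 /memv_capP[U1 h1] ->]] :=
  subvP gU _ Uv.
by exists v0, v1.
Qed.

Lemma gradedP U :
  (forall v, v \in U -> exists v0 v1,
     [/\ v0 \in U, v0 \in par false, v1 \in U, v1 \in par true & v = v0 + v1])
  -> graded U.
Proof.
move=> h; apply/subvP=> v /h[v0 [v1 [U0 h0 U1 h1 ->]]].
by apply: memv_add; apply/memv_capP.
Qed.

Lemma graded0 : graded (0%VS : {vspace V}).
Proof. exact: sub0v. Qed.

Lemma gradedT : graded (fullv : {vspace V}).
Proof. by rewrite /graded !capfv par_full. Qed.

Lemma graded_cap U I : graded U -> graded I -> graded (U :&: I)%VS.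
Proof.
move=> gU gI; apply: gradedP => v /memv_capP[/(graded_split gU) hU].
move=> /(graded_split gI) hI; move: hU hI.
move=> [u0 [u1 [U0 p0 U1 p1 ->]]] [i0 [i1 [I0 q0 I1 q1 e]]].
have e0 : u0 - i0 = i1 - u1.
  by apply/eqP; rewrite subr_eq addrAC -[X in _ == X - _]addrC -e addrK.
have d0 : u0 - i0 = 0.
  by apply: (@par_disj _ false); [rewrite rpredB | rewrite e0 rpredB].
have eu0 : u0 = i0 by apply/eqP; rewrite -subr_eq0 d0.
have eu1 : u1 = i1 by apply/esym/eqP; rewrite -subr_eq0 -e0 d0.
exists u0, u1; rewrite !memv_cap U0 U1 p0 p1; split=> //.
  by rewrite eu0 I0.
by rewrite eu1 I1.
Qed.

Variables (U I : {vspace V}).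
Hypotheses (gU : graded U) (gI : graded I) (IU : (I <= U)%VS).

Lemma gcompl_sub : (gcompl U I <= U)%VS.
Proof.
by rewrite /gcompl subv_add !(subv_trans (diffvSl _ _)) ?capvSl.
Qed.

Lemma gcompl_cap : (gcompl U I :&: I)%VS = 0%VS.
Proof.
apply/eqP; rewrite -subv0; apply/subvP=> v /memv_capP[].
case/memv_addP=> w0 W0 [w1 W1 ->] /(graded_split gI)[i0 [i1 [I0 q0 I1 q1 e]]].
have [/memv_capP[_ p0] /memv_capP[_ p1]] :
    w0 \in (U :&: par false)%VS /\ w1 \in (U :&: par true)%VS.
  by split; [apply: subvP W0 | apply: subvP W1]; apply: diffvSl.
have e0 : w0 - i0 = i1 - w1.
  by apply/eqP; rewrite subr_eq addrAC -[X in _ == X - _]addrC -e addrK.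
have d0 : w0 - i0 = 0.
  by apply: (@par_disj _ false); [rewrite rpredB | rewrite e0 rpredB].
have eu0 : w0 = i0 by apply/eqP; rewrite -subr_eq0 d0.
have eu1 : w1 = i1 by apply/esym/eqP; rewrite -subr_eq0 -e0 d0.
have z0 : w0 = 0.
  apply/eqP; rewrite -memv0 -(capv_diff (U :&: par false) I) memv_cap W0.
  by rewrite eu0.
have z1 : w1 = 0.
  apply/eqP; rewrite -memv0 -(capv_diff (U :&: par true) I) memv_cap W1.
  by rewrite eu1.
by rewrite z0 z1 addr0 mem0v.
Qed.

Lemma homog_decomp b u : u \in U -> u \in par b ->
  exists w i, [/\ w \in gcompl U I, w \in par b, i \in I & u = w + i].
Proof.
move=> Uu pu; have hu : u \in (U :&: par b)%VS by apply/memv_capP.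
have : u \in (((U :&: par b) :\: I) + ((U :&: par b) :&: I))%VS.
  by rewrite addv_diff_cap.
case/memv_addP=> w hw [i /memv_capP[_ Ii] ->]; exists w, i; split=> //.
  rewrite /gcompl; case: b {pu hu} hw => hw.
    by apply: subvP hw; apply: addvSr.
  by apply: subvP hw; apply: addvSl.
by have /memv_capP[] := subvP (diffvSl _ _) _ hw.
Qed.

Lemma gcompl_add : (gcompl U I + I)%VS = U.
Proof.
apply/eqP; rewrite eqEsubv subv_add gcompl_sub IU /=; apply/subvP=> u.
case/(graded_split gU)=> u0 [u1 [U0 p0 U1 p1 ->]].
have [w [i [Ww _ Ii ->]]] := homog_decomp U0 p0.
have [w' [i' [Ww' _ Ii' ->]]] := homog_decomp U1 p1.
by rewrite addrACA memv_add // rpredD.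
Qed.

Lemma val_qproj u : vsval (qproj U I u) = daddv_pi (gcompl U I) I u.
Proof. by rewrite comp_lfunE lfunE /= vsprojK // memv_pi. Qed.

Lemma qproj_sub u : u \in U -> u - vsval (qproj U I u) \in I.
Proof.
rewrite -{1}gcompl_add => /(daddv_pi_add gcompl_cap) e.
by rewrite val_qproj -{1}e addrC addKr memv_pi.
Qed.

Lemma qproj_val (a : quo U I) : qproj U I (vsval a) = a.
Proof.
by apply: subvs_inj; rewrite val_qproj daddv_pi_id ?gcompl_cap ?subvsP.
Qed.

Lemma qval_in (a : quo U I) : vsval a \in U.
Proof. exact: subvP gcompl_sub _ (subvsP a). Qed.

Lemma qproj_eq0 u : u \in U -> (qproj U I u == 0) = (u \in I).
Proof.
move=> Uu; have d := qproj_sub Uu.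
apply/eqP/idP=> [e | Iu]; first by move: d; rewrite e linear0 addr0.
apply: subvs_inj; rewrite linear0; apply/eqP.
rewrite -memv0 -gcompl_cap memv_cap subvsP /=.
by rewrite -[vsval _](subKr u) rpredB.
Qed.

Lemma qproj_onto (a : quo U I) : exists2 u, u \in U & qproj U I u = a.
Proof. by exists (vsval a); [apply: qval_in | apply: qproj_val]. Qed.

Lemma qproj_eq u v : u \in U -> u - v \in I -> qproj U I u = qproj U I v.
Proof.
move=> Uu d; apply/eqP; rewrite -subr_eq0 -linearB qproj_eq0 //.
by rewrite (subvP IU).
Qed.

Lemma mem_qpar b (a : quo U I) : (a \in qpar U I b) = (vsval a \in par b).
Proof. by rewrite -memv_preim lfunE. Qed.

Lemma qproj_par b u : u \in U -> u \in par b -> qproj U I u \in qpar U I b.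
Proof.
move=> Uu /(homog_decomp Uu)[w [i [Ww pw Ii e]]].
rewrite mem_qpar; suff -> : vsval (qproj U I u) = w by [].
rewrite (@qproj_eq u w) // ?e ?[_ + i - _]addrC ?addKr // -?e //.
  by rewrite val_qproj daddv_pi_id // gcompl_cap.
Qed.

Lemma qpar_full : (qpar U I false + qpar U I true)%VS = fullv.
Proof.
apply/eqP; rewrite eqEsubv subvf /=; apply/subvP=> a _.
have [u0 [u1 [U0 p0 U1 p1 e]]] := graded_split gU (qval_in a).
by rewrite -(qproj_val a) e linearD memv_add ?qproj_par.
Qed.

Lemma qpar_direct : (qpar U I false :&: qpar U I true)%VS = 0%VS.
Proof.
apply/eqP; rewrite -subv0; apply/subvP=> a /memv_capP[].
rewrite !mem_qpar => h0 h1; rewrite memv0; apply/eqP/subvs_inj.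
by rewrite linear0; apply: (@par_disj _ false).
Qed.

Definition quoSpace : superSpace F := SuperSpace qpar_full qpar_direct.

End Quotient.

Lemma linfun_funE (F : fieldType) (U V : vectType F) (f : U -> V) :
  linear f -> linfun f =1 f.
Proof.
move=> lf; pose f' : {linear U -> V} :=
  HB.pack f (GRing.isLinear.Build F U V *:%R f lf).
by move=> u; rewrite (_ : linfun f = linfun f') // lfunE.
Qed.

Section Bilinear.
Variables (F : fieldType) (U V : vectType F) (f : U -> V).
Hypothesis lf : linear f.

Lemma linf0 : f 0 = 0. Proof. by rewrite -(linfun_funE lf) linear0. Qed.
Lemma linfD u v : f (u + v) = f u + f v.
Proof. by rewrite -!(linfun_funE lf) linearD. Qed.
Lemma linfB u v : f (u - v) = f u - f v.
Proof. by rewrite -!(linfun_funE lf) linearB. Qed.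
Lemma linfZ a u : f (a *: u) = a *: f u.
Proof. by rewrite -!(linfun_funE lf) linearZ. Qed.
End Bilinear.

Section QuotientLie.
Variables (F : numClosedFieldType) (g : lieSuper F) (U I : {vspace g}).
Hypotheses (hU : subalgebra U) (hI : ideal_in U I).

Let gU : graded U := hU.1.
Let gI : graded I. Proof. by case: hI. Qed.
Let IU : (I <= U)%VS. Proof. by case: hI. Qed.

Definition quo_br (a b : quo U I) : quo U I :=
  qproj U I (br (vsval a) (vsval b)).

Let br_in u v : u \in U -> v \in U -> br u v \in U. Proof. exact: hU.2. Qed.

Let qproj_brr u v w : u \in U -> v \in U -> v - w \in I ->
  qproj U I (br u v) = qproj U I (br u w).
Proof.
move=> Uu Uv d; apply: qproj_eq; rewrite ?br_in //.
by rewrite -(linfB (br_linr u)); case: hI => _ _ h; case: (h _ _ Uu d).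
Qed.

Let qproj_brl u v w : u \in U -> v \in U -> v - w \in I ->
  qproj U I (br v u) = qproj U I (br w u).
Proof.
move=> Uu Uv d; apply: qproj_eq; rewrite ?br_in //.
by rewrite -(linfB (br_linl u)); case: hI => _ _ h; case: (h _ _ Uu d).
Qed.

Lemma quo_brE u v : u \in U -> v \in U ->
  quo_br (qproj U I u) (qproj U I v) = qproj U I (br u v).
Proof.
move=> Uu Uv; have q w : vsval (qproj U I w) \in U by exact: qval_in.
rewrite (qproj_brr Uu Uv (qproj_sub gU gI IU Uv)).
by rewrite (qproj_brl _ Uu (qproj_sub gU gI IU Uu)).
Qed.

Let V := quoSpace gU gI IU.

Fact quo_br_linl (b : V) : linear (quo_br^~ b : V -> V).
Proof.
by move=> k a a'; rewrite /quo_br linearP br_linl linearP.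
Qed.

Fact quo_br_linr (a : V) : linear (quo_br a : V -> V).
Proof.
by move=> k b b'; rewrite /quo_br linearP br_linr linearP.
Qed.

Fact quo_br_par i j (a b : V) :
  a \in par i -> b \in par j -> quo_br a b \in (par (i (+) j) : {vspace V}).
Proof.
rewrite /= !mem_qpar => pa pb; rewrite -mem_qpar qproj_par ?br_par //.
by rewrite br_in ?qval_in.
Qed.

Fact quo_br_anti i j (a b : V) : a \in par i -> b \in par j ->
  quo_br a b = - ((-1) ^+ (i && j) *: quo_br b a).
Proof.
rewrite /= !mem_qpar => pa pb.
by rewrite /quo_br (br_anti pa pb) linearN linearZ.
Qed.

Fact quo_br_jacobi i j (a b c : V) : a \in par i -> b \in par j ->
  quo_br a (quo_br b c)
  = quo_br (quo_br a b) c + (-1) ^+ (i && j) *: quo_br b (quo_br a c).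
Proof.
rewrite /= !mem_qpar => pa pb.
have q (w : V) : vsval w \in U by exact: qval_in.
have e (w : V) : w = qproj U I (vsval w) by rewrite qproj_val.
rewrite (e a) (e b) (e c) !quo_brE ?br_in // (br_jacobi _ pa pb).
by rewrite linearD linearZ.
Qed.

Definition quoLie : lieSuper F :=
  LieSuper quo_br_linl quo_br_linr quo_br_par quo_br_anti quo_br_jacobi.

End QuotientLie.

(* The action induced on the subquotient [X / Y] of a [g]-module by [s : h -> g]
   that respects brackets up to elements mapping [X] into [Y]. *)
Section QuotientRep.
Variables (F : numClosedFieldType) (g h : lieSuper F) (M : superMod g).
Variables (X Y : {vspace M}) (s : h -> g).
Hypotheses (gX : graded X) (gY : graded Y) (YX : (Y <= X)%VS).
Hypotheses (s_lin : linear s)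
  (s_par : forall b a, a \in par b -> s a \in par b)
  (s_X : forall a m, m \in X -> act (s a) m \in X)
  (s_Y : forall a m, m \in Y -> act (s a) m \in Y)
  (s_br : forall a b m, m \in X ->
     act (s (br a b)) m - act (br (s a) (s b)) m \in Y).

Definition quo_act (a : h) (m : quo X Y) : quo X Y :=
  qproj X Y (act (s a) (vsval m)).

Let qE a m : m \in X -> quo_act a (qproj X Y m) = qproj X Y (act (s a) m).
Proof.
move=> Xm; apply/esym/qproj_eq => //; first exact: s_X.
have [_ lr _ _] := act_rep M.
by rewrite -(linfB (lr _)) s_Y // qproj_sub.
Qed.

Fact quo_act_rep : @is_rep F h (quoSpace gX gY YX) quo_act.
Proof.
have [ll lr pp bb] := act_rep M; split.
- by move=> m k a b; rewrite /quo_act s_lin ll linearP.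
- by move=> a k m m'; rewrite /quo_act linearP lr linearP.
- move=> i j a m; rewrite /= !mem_qpar => pa pm.
  rewrite -mem_qpar qproj_par ?pp ?s_X ?qval_in //; last exact: s_par.
- move=> i j a b m pa pb; rewrite -[m]qproj_val //.
  have Xm : vsval m \in X by exact: qval_in.
  rewrite !qE ?s_X // (qproj_eq gX gY YX _ (s_br a b Xm)) ?s_X //.
  by rewrite (bb _ _ _ _ _ (s_par pa) (s_par pb)) linearB linearZ.
Qed.

End QuotientRep.

Section Adjoint.
Variables (F : numClosedFieldType) (g : lieSuper F).

Fact adj_rep : @is_rep F g g br.
Proof.
split; [exact: br_linl | exact: br_linr | exact: br_par |].
by move=> a b x y m pa pb; rewrite (br_jacobi _ pa pb) addrK.
Qed.

Definition adj : derAlg g := DerAlg adj_rep (@br_jacobi F g : forall a b x u v, _).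

Variables U I : {vspace g}.
Hypotheses (hU : ideal_in fullv U) (hI : ideal_in fullv I) (IU : (I <= U)%VS).

Fact ideal_subalgebra : subalgebra U.
Proof.
by case: hU => gU _ h; split=> // u v Uu Uv; case: (h u v (memvf _) Uv).
Qed.

Fact ideal_in_sub : ideal_in U I.
Proof. by case: hI => gI _ h; split=> // u v _; apply: h; apply: memvf. Qed.

Let gU : graded U. Proof. by case: hU. Qed.
Let gI : graded I. Proof. by case: hI. Qed.

Let W := quoLie ideal_subalgebra ideal_in_sub.
Let brU x u : u \in U -> br x u \in U.
Proof. by case: hU => _ _ h /(h x _ (memvf _))[]. Qed.
Let brI x u : u \in I -> br x u \in I.
Proof. by case: hI => _ _ h /(h x _ (memvf _))[]. Qed.

Definition quoAlg_act : g -> W -> W := @quo_act F g g adj U I id.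

Fact quoAlg_rep : @is_rep F g W quoAlg_act.
Proof.
have := @quo_act_rep F g g adj U I id gU gI IU.
case=> //.
- by move=> a x m _; rewrite /= subrr mem0v.
Qed.

Fact quoAlg_der i j x (u v : W) : x \in par i -> u \in par j ->
  quoAlg_act x (br u v)
  = br (quoAlg_act x u) v + (-1) ^+ (i && j) *: br u (quoAlg_act x v).
Proof.
rewrite {1}/par /= mem_qpar => px pu.
have e (w : W) : w = qproj U I (vsval w) by rewrite qproj_val //; exact: graded0.
have q (w : W) : vsval w \in U by exact: qval_in.
have aE z w : w \in U -> quoAlg_act z (qproj U I w) = qproj U I (br z w).
  move=> Uw; apply/esym/qproj_eq => //; first exact: brU.
  by rewrite /= -(linfB (br_linr z)) brI // qproj_sub.
have bE := quo_brE ideal_subalgebra ideal_in_sub.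
rewrite [v]e [u]e /= bE ?aE ?bE ?brU // (br_jacobi _ px pu).
by rewrite linearD linearZ.
Qed.

(* [U / I] as a Lie superalgebra acted on by [g] through the adjoint action. *)
Definition quoAlg : derAlg g := DerAlg quoAlg_rep quoAlg_der.

End Adjoint.

(* For an odd [x], [x^2 = [x, x] / 2] acts on a module [M] as
   [act (2^-1 *: br x x)]; [inv_sq x M] is [M^{x^2}]. *)
Section DufloSerganova.
Variables (F : numClosedFieldType) (g : lieSuper F) (x : odd_part g).

Definition act_end (M : superMod g) : 'End(M) := linfun (act (vsval x)).

Definition inv_sq (M : superMod g) : {vspace M} :=
  lker (linfun (act (2^-1 *: br (vsval x) (vsval x))) : 'End(M)).

Definition dsKer (M : superMod g) : {vspace M} :=
  (inv_sq M :&: lker (act_end M))%VS.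

Definition dsIm (M : superMod g) : {vspace M} := (act_end M @: inv_sq M)%VS.

Let xodd : vsval x \in par true. Proof. exact: subvsP. Qed.

Section Mod.
Variable M : superMod g.
Let ll := let: And4 h _ _ _ := act_rep M in h.
Let lr := let: And4 _ h _ _ := act_rep M in h.
Let pp := let: And4 _ _ h _ := act_rep M in h.
Let bb := let: And4 _ _ _ h := act_rep M in h.

Lemma act_endE (m : M) : act_end M m = act (vsval x) m.
Proof. exact: linfun_funE. Qed.

Lemma mem_inv_sq (m : M) :
  (m \in inv_sq M) = (act (vsval x) (act (vsval x) m) == 0).
Proof.
rewrite memv_ker linfun_funE // (linfZ (ll m)) (bb _ xodd xodd).
rewrite expr1 scaleN1r opprK -mulr2n -scaler_nat scalerA mulVf ?scale1r //.
by rewrite pnatr_eq0.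
Qed.

Lemma mem_dsKer (m : M) : (m \in dsKer M) = (act (vsval x) m == 0).
Proof.
rewrite memv_cap mem_inv_sq memv_ker act_endE.
by case: (act _ m =P 0) => [-> |]; rewrite ?andbF // (linf0 (lr _)) eqxx.
Qed.

Lemma dsImP (m : M) :
  reflect (exists2 u : M, act (vsval x) (act (vsval x) u) = 0
                          & m = act (vsval x) u) (m \in dsIm M).
Proof.
apply: (iffP memv_imgP) => [[u]|[u e ->]].
  by rewrite mem_inv_sq act_endE => /eqP e ->; exists u.
by exists u; rewrite ?act_endE // mem_inv_sq e.
Qed.

Let act_par i (m : M) : m \in par i -> act (vsval x) m \in par (~~ i).
Proof. by move=> h; have := pp xodd h. Qed.

Lemma dsKer_graded : graded (dsKer M).
Proof.
apply: gradedP => m; rewrite mem_dsKer => /eqP e.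
have [m0 [m1 [p0 p1 em]]] := par_split m.
have := e; rewrite em (linfD (lr _)) => /eqP; rewrite addr_eq0 => /eqP e01.
have z0 : act (vsval x) m0 = 0.
  apply: (@par_disj _ _ _ true); first exact: (act_par p0).
  by rewrite e01 rpredN; exact: (act_par p1).
have z1 : act (vsval x) m1 = 0 by apply/eqP; rewrite -oppr_eq0 -e01 z0.
by exists m0, m1; rewrite !mem_dsKer z0 z1.
Qed.

Lemma dsIm_graded : graded (dsIm M).
Proof.
apply: gradedP => m /dsImP[u e ->].
have [u0 [u1 [p0 p1 eu]]] := par_split u.
have := e; rewrite eu !(linfD (lr _)) => /eqP; rewrite addr_eq0 => /eqP e01.
have z0 : act (vsval x) (act (vsval x) u0) = 0.
  apply: (@par_disj _ _ _ false); first exact: (act_par (act_par p0)).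
  by rewrite e01 rpredN; exact: (act_par (act_par p1)).
have z1 : act (vsval x) (act (vsval x) u1) = 0.
  by apply/eqP; rewrite -oppr_eq0 -e01 z0.
exists (act (vsval x) u1), (act (vsval x) u0).
rewrite addrC (act_par p0) (act_par p1); split=> //; apply/dsImP.
- by exists u1.
- by exists u0.
Qed.

Lemma dsIm_sub : (dsIm M <= dsKer M)%VS.
Proof. by apply/subvP=> m /dsImP[u e ->]; rewrite mem_dsKer e. Qed.

Definition DSspace : superSpace F := quoSpace dsKer_graded dsIm_graded dsIm_sub.

Definition DSproj : 'Hom(M, DSspace) := qproj (dsKer M) (dsIm M).

End Mod.

Section Lie.
Variable A : derAlg g.
Local Notation X := (da_act (vsval x)).

Let derX i u v : u \in par i ->
  X (br u v : A) = br (X u) v + (-1) ^+ i *: br u (X v).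
Proof. by move=> pu; exact: (@da_der F g A true i _ u v xodd pu). Qed.

Let kerE (u : A) : (u \in dsKer A) = (X u == 0). Proof. exact: mem_dsKer. Qed.

Let lX : linear (X : A -> A). Proof. by case: (da_rep A). Qed.

Fact dsKer_subalgebra : subalgebra (dsKer A : {vspace A}).
Proof.
split; first exact: (dsKer_graded A).
move=> u v /(graded_split (dsKer_graded A))[u0 [u1 []]].
rewrite !kerE => /eqP k0 p0 /eqP k1 p1 -> /eqP kv.
rewrite (linfD (br_linl _)) (linfD lX) (derX _ p0) (derX _ p1) k0 k1 kv.
by rewrite (linf0 (br_linl _)) !(linf0 (br_linr _)) !scaler0 !addr0.
Qed.

Fact dsIm_ideal : ideal_in (dsKer A) (dsIm A : {vspace A}).
Proof.
split; [exact: (dsIm_graded A) | exact: (dsIm_sub A) |] => u i Ku Ii.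
have sgn (b : bool) (w : A) : (-1) ^+ b *: ((-1) ^+ b *: w) = w.
  by rewrite scalerA -expr2 sqrr_sign scale1r.
have hom b c (u' w : A) : u' \in par b -> w \in par c -> X u' = 0 ->
    X (X w) = 0 -> br u' (X w) \in dsIm A /\ br (X w) u' \in dsIm A.
  move=> pu pw k e.
  have e1 : br u' (X w) = X ((-1) ^+ b *: br u' w).
    rewrite (linfZ lX) (derX _ pu) k (linf0 (br_linl _)) add0r.
    by rewrite sgn.
  have e2 : br (X w) u' = X (br w u').
    by rewrite (derX _ pw) k (linf0 (br_linr _)) scaler0 addr0.
  split; apply/dsImP.
    exists ((-1) ^+ b *: br u' w) => //=.
    rewrite -e1 (derX _ pu) k e (linf0 (br_linl _)) (linf0 (br_linr _)).
    by rewrite scaler0 addr0.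
  exists (br w u') => //=.
  have pXw : X w \in par (~~ c).
    by have [_ _ h _] := da_rep A; exact: (h _ _ _ _ xodd pw).
  rewrite -e2 (derX _ pXw) k e (linf0 (br_linl _)) (linf0 (br_linr _)).
  by rewrite scaler0 addr0.
have [u0 [u1 []]] := graded_split (dsKer_graded A) Ku.
rewrite !kerE => /eqP k0 p0 /eqP k1 p1 ->.
have [i0 [i1 [I0 q0 I1 q1 ->]]] := graded_split (dsIm_graded A) Ii.
have homI b (j : A) : j \in dsIm A -> j \in par b ->
    exists2 w : A, w \in par (~~ b) & j = X w /\ X (X w) = 0.
  move=> /dsImP[w /= e ej] pj.
  have [w0 [w1 [r0 r1 ew]]] := par_split w.
  have [_ _ hp _] := da_rep A.
  have P0 : X w0 \in par true := hp _ _ _ _ xodd r0.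
  have P1 : X w1 \in par false := hp _ _ _ _ xodd r1.
  case: b pj => pj.
    have z : X w1 = 0.
      apply: (@par_disj _ _ _ false) => //=.
      have -> : X w1 = j - X w0 by rewrite ej ew (linfD lX) addrC addKr.
      by rewrite rpredB.
    exists w0 => //; rewrite ej -e ew (linfD lX) z addr0.
    by rewrite ew (linfD lX) z addr0 in e *.
  have z : X w0 = 0.
    apply: (@par_disj _ _ _ true) => //=.
    have -> : X w0 = j - X w1 by rewrite ej ew (linfD lX) addrK.
    by rewrite rpredB.
  exists w1 => //; move: e; rewrite ej ew (linfD lX) z add0r.
  by split.
have [w0 s0 [-> e0]] := homI _ _ I0 q0; have [w1 s1 [-> e1]] := homI _ _ I1 q1.
have [h00 h00'] := hom _ _ _ _ p0 s0 k0 e0.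
have [h01 h01'] := hom _ _ _ _ p0 s1 k0 e1.
have [h10 h10'] := hom _ _ _ _ p1 s0 k1 e0.
have [h11 h11'] := hom _ _ _ _ p1 s1 k1 e1.
by rewrite !(linfD (br_linl _)) !(linfD (br_linr _)) !rpredD.
Qed.

Definition DSlie : lieSuper F := quoLie dsKer_subalgebra dsIm_ideal.

End Lie.

Section DSmodule.
Variable M : superMod g.
Local Notation X := (act (vsval x)).


Let hk i u m : u \in par i -> br (vsval x) u = 0 -> m \in dsKer M ->
  act u m \in dsKer M.
Proof.
have [ll lr pp bb] := act_rep M.
move=> pu k; rewrite !mem_dsKer => /eqP e.
have := bb _ _ _ _ m xodd pu; rewrite k e (linf0 (ll _)) (linf0 (lr _)).
by rewrite scaler0 subr0 => <-.
Qed.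

Let kerAdj (u : g) :
  u \in (dsKer (adj g) : {vspace g}) -> br (vsval x) u = 0.
Proof. by move=> h; apply/eqP; rewrite -(@mem_dsKer (adj g)). Qed.

Let actK (u : g) m : u \in dsKer (adj g) -> m \in dsKer M ->
  act u m \in dsKer M.
Proof.
have [ll lr pp bb] := act_rep M.
move=> Ku Km; have [u0 [u1 []]] := graded_split (@dsKer_graded (adj g)) Ku.
move=> /kerAdj k0 p0 /kerAdj k1 p1 ->.
rewrite (linfD (ll _)) rpredD //.
  exact: hk p0 k0 Km.
exact: hk p1 k1 Km.
Qed.

Let xact i u m : u \in par i ->
  X (act u m : M) = act (br (vsval x) u) m + (-1) ^+ i *: act u (X m).
Proof.
have [ll lr pp bb] := act_rep M.
by move=> pu; rewrite (bb _ _ _ _ _ xodd pu) subrK.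
Qed.

Let actI (u : g) m : u \in dsKer (adj g) -> m \in dsIm M ->
  act u m \in dsIm M.
Proof.
have [ll lr pp bb] := act_rep M.
move=> Ku /dsImP[v e ->].
have sgn (b : bool) (w : M) : (-1) ^+ b *: ((-1) ^+ b *: w) = w.
  by rewrite scalerA -expr2 sqrr_sign scale1r.
have hom b (u' : g) : u' \in par b -> br (vsval x) u' = 0 -> act u' (X v) \in dsIm M.
  move=> pu k; have e1 (m' : M) : X (act u' m') = (-1) ^+ b *: act u' (X m').
    by rewrite (xact _ pu) k (linf0 (ll _)) add0r.
  apply/dsImP; exists ((-1) ^+ b *: act u' v); rewrite !(linfZ (lr _)) !e1.
    by rewrite (linfZ (lr _)) e1 e (linf0 (lr _)) !scaler0.
  by rewrite sgn.
have [u0 [u1 []]] := graded_split (@dsKer_graded (adj g)) Ku.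
move=> /kerAdj k0 p0 /kerAdj k1 p1 ->.
by rewrite (linfD (ll _)) rpredD // (hom _ _ p0 k0, hom _ _ p1 k1).
Qed.

Let actJ (u : g) m : u \in dsIm (adj g) -> m \in dsKer M ->
  act u m \in dsIm M.
Proof.
have [ll lr pp bb] := act_rep M.
move=> Iu Km; have Ku := subvP (@dsIm_sub (adj g)) _ Iu.
have /eqP XK : X (act u m) == 0 by rewrite -mem_dsKer actK.
have /eqP Xm : X m == 0 by rewrite -mem_dsKer.
case/dsImP: Iu => v _ ev; have [v0 [v1 [p0 p1 e]]] := par_split v.
have E : act u m = X (act v m).
  rewrite ev e /= (linfD (br_linr _)) !(linfD (ll _)) (linfD (lr _)).
  rewrite (xact _ p0) (xact _ p1) Xm !(linf0 (lr _)) !scaler0 !addr0 //.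
by apply/dsImP; exists (act v m); rewrite -E.
Qed.

Fact DSmod_rep :
  @is_rep F (DSlie (adj g)) (DSspace M)
    (@quo_act F g (DSlie (adj g)) M (dsKer M) (dsIm M) vsval).
Proof.
have gK := @dsKer_graded (adj g); have gI := @dsIm_graded (adj g).
have IK := @dsIm_sub (adj g).
apply: quo_act_rep.
- by move=> k a b; rewrite linearP.
- by move=> b a; rewrite /= mem_qpar.
- by move=> a m Km; apply: actK => //; apply: qval_in.
- by move=> a m Im; apply: actI => //; apply: qval_in.
- move=> a b m Km; have [ll lr pp bb] := act_rep M.
  rewrite -(linfB (ll m)); apply: actJ => //.
  rewrite -opprB rpredN; apply: qproj_sub => //.
  by case: (dsKer_subalgebra (adj g)) => _; apply; apply: qval_in.
Qed.

Definition DSmod : superMod (DSlie (adj g)) := SuperMod DSmod_rep.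

End DSmodule.
End DufloSerganova.

Section GeneralLinear.
Variables (F : numClosedFieldType) (m n : nat).
Implicit Types X Y Z : 'M[F]_(m + n).

Definition gl_part (b : bool) X : 'M[F]_(m + n) :=
  if b then block_mx 0 (ursubmx X) (dlsubmx X) 0
  else block_mx (ulsubmx X) 0 0 (drsubmx X).

Definition gl_par (b : bool) : {vspace 'M[F]_(m + n)} :=
  lker (linfun (gl_part (~~ b))).

Definition gl_br X Y : 'M[F]_(m + n) :=
  \sum_(a : bool) \sum_(b : bool)
     (gl_part a X *m gl_part b Y - (-1) ^+ (a && b) *: (gl_part b Y *m gl_part a X)).

Fact gl_part_lin b : linear (gl_part b).
Proof.
move=> k X Y; case: b; rewrite /gl_part scale_block_mx add_block_mx;
  by congr block_mx; apply/matrixP=> i j; rewrite !mxE ?mulr0 ?addr0.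
Qed.

Lemma gl_partD X : X = gl_part false X + gl_part true X.
Proof. by rewrite add_block_mx !addr0 !add0r submxK. Qed.

Lemma mem_gl_par b X : (X \in gl_par b) = (gl_part (~~ b) X == 0).
Proof. by rewrite memv_ker linfun_funE //; apply: gl_part_lin. Qed.

Lemma gl_partK a b X : gl_part a (gl_part b X) = if a == b then gl_part b X else 0.
Proof.
case: a b => [] []; rewrite /gl_part ?block_mxKul ?block_mxKur ?block_mxKdl;
  by rewrite ?block_mxKdr ?block_mx_const ?block_mx0 //; exact: block_mx0.
Qed.

Lemma gl_part_in b X : gl_part b X \in gl_par b.
Proof. by rewrite mem_gl_par gl_partK; case: b. Qed.

Lemma gl_par_id b X : X \in gl_par b -> gl_part b X = X.
Proof.
rewrite mem_gl_par => /eqP h; rewrite [RHS]gl_partD.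
by case: b h => /= ->; rewrite ?addr0 ?add0r.
Qed.

Lemma gl_par_n a b X : X \in gl_par b -> a != b -> gl_part a X = 0.
Proof. by rewrite mem_gl_par => /eqP h; case: a b h => [] []. Qed.

Fact gl_par_full : (gl_par false + gl_par true)%VS = fullv.
Proof.
apply/eqP; rewrite eqEsubv subvf /=; apply/subvP=> X _.
by rewrite [X]gl_partD memv_add ?gl_part_in.
Qed.

Fact gl_par_direct : (gl_par false :&: gl_par true)%VS = 0%VS.
Proof.
apply/eqP; rewrite -subv0; apply/subvP=> X /memv_capP[h0 h1].
by rewrite memv0 [X]gl_partD (gl_par_n h1) // (gl_par_n h0) // addr0.
Qed.

Definition gl_space : superSpace F := SuperSpace gl_par_full gl_par_direct.

Lemma gl_mul_par a b X Y : X \in gl_par a -> Y \in gl_par b ->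
  X *m Y \in gl_par (a (+) b).
Proof.
move=> /gl_par_id <- /gl_par_id <-; rewrite mem_gl_par.
case: a b => [] []; rewrite /gl_part /= mulmx_block !mul0mx !mulmx0;
  by rewrite ?addr0 ?add0r ?block_mxKul ?block_mxKur ?block_mxKdl ?block_mxKdr;
  rewrite block_mx0.
Qed.

Lemma gl_brE a b X Y : X \in gl_par a -> Y \in gl_par b ->
  gl_br X Y = X *m Y - (-1) ^+ (a && b) *: (Y *m X).
Proof.
move=> pX pY; rewrite /gl_br (bigD1 a) //= [X in _ + X]big1 ?addr0; last first.
  move=> c ca; apply: big1 => d _.
  by rewrite (gl_par_n pX ca) mul0mx mulmx0 scaler0 subr0.
rewrite (bigD1 b) //= [X in _ + X]big1 ?addr0; last first.
  by move=> d db; rewrite (gl_par_n pY db) mul0mx mulmx0 scaler0 subr0.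
by rewrite !gl_par_id.
Qed.

Fact gl_br_linl Y : linear (gl_br^~ Y).
Proof.
move=> k X X'; rewrite /gl_br scaler_sumr -big_split; apply: eq_bigr => a _.
rewrite scaler_sumr -big_split; apply: eq_bigr => b _ /=.
rewrite gl_part_lin mulmxDl mulmxDr -scalemxAl -scalemxAr scalerDr scalerBr.
by rewrite opprD addrACA !scalerA mulrC.
Qed.

Fact gl_br_linr X : linear (gl_br X).
Proof.
move=> k Y Y'; rewrite /gl_br scaler_sumr -big_split; apply: eq_bigr => a _.
rewrite scaler_sumr -big_split; apply: eq_bigr => b _ /=.
rewrite gl_part_lin mulmxDl mulmxDr -scalemxAl -scalemxAr scalerDr scalerBr.
by rewrite opprD addrACA !scalerA mulrC.
Qed.

Fact gl_br_par a b X Y : X \in gl_par a -> Y \in gl_par b ->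
  gl_br X Y \in gl_par (a (+) b).
Proof.
move=> pX pY; rewrite (gl_brE pX pY) rpredB ?(gl_mul_par pX pY) // rpredZ //.
by rewrite addbC (gl_mul_par pY pX).
Qed.

Fact gl_br_anti a b X Y : X \in gl_par a -> Y \in gl_par b ->
  gl_br X Y = - ((-1) ^+ (a && b) *: gl_br Y X).
Proof.
move=> pX pY; rewrite (gl_brE pX pY) (gl_brE pY pX) andbC scalerBr scalerA.
by rewrite -expr2 sqrr_sign scale1r opprB.
Qed.

Fact gl_br_jacobi a b X Y Z : X \in gl_par a -> Y \in gl_par b ->
  gl_br X (gl_br Y Z)
  = gl_br (gl_br X Y) Z + (-1) ^+ (a && b) *: gl_br Y (gl_br X Z).
Proof.
move=> pX pY.
have hom c Z' : Z' \in gl_par c -> gl_br X (gl_br Y Z')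
  = gl_br (gl_br X Y) Z' + (-1) ^+ (a && b) *: gl_br Y (gl_br X Z').
  move=> pZ; rewrite (gl_brE pX (gl_br_par pY pZ)) (gl_brE pY pZ).
  rewrite (gl_brE (gl_br_par pX pY) pZ) (gl_brE pX pY).
  rewrite (gl_brE pY (gl_br_par pX pZ)) (gl_brE pX pZ).
  rewrite !(mulmxDl, mulmxDr, mulmxN, mulNmx) -?scalemxAl -?scalemxAr !mulmxA.
  apply/matrixP=> i j; rewrite !mxE.
  by case: a b c {pX pY pZ} => [] [] [] /=; rewrite ?expr0 ?expr1; ring.
rewrite [Z]gl_partD !(linfD (gl_br_linr _)) scalerDr addrACA.
by rewrite !(hom _ _ (gl_part_in _ Z)).
Qed.

Definition gl : lieSuper F :=
  @LieSuper F gl_space gl_br gl_br_linl gl_br_linr gl_br_par gl_br_anti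
    gl_br_jacobi.

End GeneralLinear.

Section SubHelpers.
Variables (F : numClosedFieldType) (g : lieSuper F).
Implicit Types U I : {vspace g}.

Fact ideal_in0 U : ideal_in U 0%VS.
Proof.
split; [exact: graded0 | exact: sub0v |] => u v _; rewrite memv0 => /eqP ->.
by rewrite (linf0 (br_linr u)) (linf0 (br_linl u)) mem0v.
Qed.

Fact ideal_inT : ideal_in (fullv : {vspace g}) fullv.
Proof. by split; [exact: gradedT | exact: subvf |] => u v; rewrite !memvf. Qed.

Definition subLie U (hU : subalgebra U) : lieSuper F := quoLie hU (ideal_in0 U).

Lemma subalgebra_cap U I :
  subalgebra U -> subalgebra I -> subalgebra (U :&: I)%VS.
Proof.
move=> [gU hU] [gI hI]; split; first exact: graded_cap.
by move=> u v /memv_capP[a b] /memv_capP[c d]; rewrite memv_cap hU ?hI.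
Qed.

Lemma graded_span (X : seq g) :
  (forall u, u \in X -> u \in par false \/ u \in par true) ->
  graded <<X>>%VS.
Proof.
move=> h; apply/span_subvP => u Xu; have Su := memv_span Xu.
case: (h u Xu) => pu.
  by rewrite -[u]addr0 memv_add ?mem0v // memv_cap Su.
by rewrite -[u]add0r memv_add ?mem0v // memv_cap Su.
Qed.

Lemma br_span (X Y : seq g) U :
  (forall u v, u \in X -> v \in Y -> br u v \in U) ->
  forall u v, u \in <<X>>%VS -> v \in <<Y>>%VS -> br u v \in U.
Proof.
move=> h u v Xu Yv; have hX w : w \in X -> br w v \in U.
  move=> Xw; have : (<<Y>> <= linfun (br w) @^-1: U)%VS.
    apply/span_subvP => y Yy; rewrite -memv_preim linfun_funE ?h //.
    exact: br_linr.
  move/subvP/(_ v Yv); rewrite -memv_preim linfun_funE //; exact: br_linr.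
have : (<<X>> <= linfun (br^~ v) @^-1: U)%VS.
  apply/span_subvP => y Xy; rewrite -memv_preim linfun_funE ?hX //.
  exact: br_linl.
move/subvP/(_ u Xu); rewrite -memv_preim linfun_funE //; exact: br_linl.
Qed.

End SubHelpers.

Section Queer.
Variables (F : numClosedFieldType) (n : nat).
Implicit Types (A B : 'M[F]_n) (K : {set 'I_n}).

Definition Tmx A B : 'M[F]_(n + n) := block_mx A B B A.

Definition q_sub : {vspace gl F n n} :=
  limg (linfun (fun p : 'M[F]_n * 'M[F]_n => Tmx p.1 p.2)).

Fact Tmx_lin : linear (fun p : 'M[F]_n * 'M[F]_n => Tmx p.1 p.2).
Proof.
by move=> k [A B] [A' B']; rewrite /Tmx scale_block_mx add_block_mx.
Qed.

Lemma q_subP X :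
  reflect (exists A B, X = Tmx A B) (X \in (q_sub : {vspace gl F n n})).
Proof.
apply: (iffP memv_imgP) => [[[A B] _ ->]|[A [B ->]]].
  by exists A, B; rewrite linfun_funE //; exact: Tmx_lin.
by exists (A, B); rewrite ?memvf // linfun_funE //; exact: Tmx_lin.
Qed.

Lemma mem_Tmx A B : Tmx A B \in (q_sub : {vspace gl F n n}).
Proof. by apply/q_subP; exists A, B. Qed.

Lemma Tmx_even A : Tmx A 0 \in (par false : {vspace gl F n n}).
Proof.
rewrite mem_gl_par /gl_part /Tmx /= block_mxKur block_mxKdl.
by rewrite block_mx0.
Qed.

Lemma Tmx_odd B : Tmx 0 B \in (par true : {vspace gl F n n}).
Proof.
rewrite mem_gl_par /gl_part /Tmx /= block_mxKul block_mxKdr.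
by rewrite block_mx0.
Qed.

Lemma TmxD A B : Tmx A B = Tmx A 0 + Tmx 0 B.
Proof. by rewrite /Tmx add_block_mx !addr0 !add0r. Qed.

Lemma Tmx_br A B A' B' :
  br (Tmx A B : gl F n n) (Tmx A' B')
  = Tmx (A *m A' - A' *m A + (B *m B' + B' *m B))
        (A *m B' - B' *m A + (B *m A' - A' *m B)).
Proof.
rewrite [X in br X _]TmxD [X in br _ X]TmxD.
rewrite (linfD (br_linl _)) !(linfD (br_linr _)).
rewrite /= (gl_brE (Tmx_even A) (Tmx_even A')) (gl_brE (Tmx_even A) (Tmx_odd B')).
rewrite (gl_brE (Tmx_odd B) (Tmx_even A')) (gl_brE (Tmx_odd B) (Tmx_odd B')) /=.
rewrite /Tmx !mulmx_block !(mul0mx, mulmx0, addr0, add0r) expr0 expr1.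
rewrite !scale_block_mx !opp_block_mx !add_block_mx.
rewrite !(scale1r, scaleN1r, opprK, scaler0, oppr0, addr0, add0r).
by congr block_mx; rewrite ?addrA.
Qed.

Fact q_subalgebra : subalgebra (q_sub : {vspace gl F n n}).
Proof.
split.
  apply: gradedP => X /q_subP[A [B ->]]; exists (Tmx A 0), (Tmx 0 B).
  by rewrite !mem_Tmx Tmx_even Tmx_odd -TmxD.
by move=> X Y /q_subP[A [B ->]] /q_subP[A' [B' ->]]; rewrite Tmx_br mem_Tmx.
Qed.

Definition q : lieSuper F := subLie q_subalgebra.

Definition T A B : q := qproj q_sub 0 (Tmx A B).

Definition H (i : 'I_n) : q := T 0 (delta_mx i i).

Definition evenpart (u : q) : 'M[F]_n := ulsubmx (vsval u).
Definition oddpart (u : q) : 'M[F]_n := ursubmx (vsval u).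

Lemma val_T A B : vsval (T A B) = Tmx A B.
Proof.
have d := qproj_sub q_subalgebra.1 (@graded0 _ _) (sub0v _) (mem_Tmx A B).
by apply/esym/eqP; rewrite -subr_eq0 -memv0.
Qed.

Lemma T_surj (u : q) : u = T (evenpart u) (oddpart u).
Proof.
apply: subvs_inj; rewrite val_T.
have /q_subP[A [B e]] : vsval u \in (q_sub : {vspace gl F n n}).
  exact: qval_in.
by rewrite /evenpart /oddpart e /Tmx block_mxKul block_mxKur.
Qed.

Lemma evenpart_T A B : evenpart (T A B) = A.
Proof. by rewrite /evenpart val_T block_mxKul. Qed.

Lemma oddpart_T A B : oddpart (T A B) = B.
Proof. by rewrite /oddpart val_T block_mxKur. Qed.

Lemma T_br A B A' B' :
  br (T A B) (T A' B')
  = T (A *m A' - A' *m A + (B *m B' + B' *m B))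
      (A *m B' - B' *m A + (B *m A' - A' *m B)).
Proof.
rewrite {1}/br /= /quo_br !val_T; by rewrite [X in qproj _ _ X]Tmx_br.
Qed.

Lemma T_lin : linear (fun p : 'M[F]_n * 'M[F]_n => T p.1 p.2).
Proof.
by move=> k p p'; rewrite /T (Tmx_lin k p p') linearP.
Qed.

Lemma T_even A : T A 0 \in par false.
Proof. by rewrite mem_qpar val_T; exact: Tmx_even. Qed.

Lemma T_odd B : T 0 B \in par true.
Proof. by rewrite mem_qpar val_T; exact: Tmx_odd. Qed.

Lemma T_split A B : T A B = T A 0 + T 0 B.
Proof. by rewrite /T TmxD linearD. Qed.

(* [{T_{A,B} : tr B = 0}]. *)
Definition sq_sub : {vspace q} :=
  lker (linfun (fun u : q => \tr (oddpart u) : F^o)).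

Definition q_center : {vspace q} := <[T 1%:M 0]>%VS.

Lemma mem_sq_sub (u : q) : (u \in sq_sub) = (\tr (oddpart u) == 0).
Proof.
rewrite memv_ker linfun_funE // => k v w; rewrite /oddpart linearP.
rewrite -[RHS]/(k * _ + _) -mxtraceZ -mxtraceD; congr (\tr _).
by apply/matrixP=> i j; rewrite !mxE.
Qed.

Lemma tr_oddpart_br (u v : q) : \tr (oddpart (br u v)) = 0.
Proof.
rewrite (T_surj u) (T_surj v) T_br oddpart_T mxtraceD !linearB /=.
rewrite (mxtrace_mulC (evenpart u)) (mxtrace_mulC (oddpart u)).
by rewrite !subrr addr0.
Qed.

Fact sq_ideal : ideal_in fullv sq_sub.
Proof.
split; [|exact: subvf|].
  apply: gradedP => u; rewrite mem_sq_sub => tr0.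
  exists (T (evenpart u) 0), (T 0 (oddpart u)).
  rewrite !mem_sq_sub !oddpart_T mxtrace0 eqxx tr0 T_even T_odd -T_split.
  by split=> //; exact: T_surj.
by move=> u v _ _; rewrite !mem_sq_sub !tr_oddpart_br eqxx.
Qed.

Lemma T1_central u : br (T 1%:M 0) u = 0 /\ br u (T 1%:M 0) = 0.
Proof.
have T0 : T 0 0 = 0 by rewrite /T /Tmx block_mx0 linear0.
rewrite (T_surj u) !T_br !(mul1mx, mulmx1, mul0mx, mulmx0).
by rewrite !subrr !addr0 T0.
Qed.

Fact q_center_ideal : ideal_in fullv q_center.
Proof.
split; [|exact: subvf|].
  apply: gradedP => u hu; exists u, 0; rewrite !mem0v addr0; split=> //.
  by case/vlineP: hu => k ->; rewrite rpredZ ?T_even.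
move=> u v _ /vlineP[k ->]; have [e1 e2] := T1_central u.
by rewrite (linfZ (br_linl _)) (linfZ (br_linr _)) e1 e2 !scaler0 mem0v.
Qed.

Definition qK_gens K : seq q :=
  [seq T (delta_mx i j) 0 | i <- enum K, j <- enum K]
  ++ [seq T 0 (delta_mx i j) | i <- enum K, j <- enum K].

Definition qK_sub K : {vspace q} := <<qK_gens K>>%VS.

Definition sqK_sub K : {vspace q} := (qK_sub K :&: sq_sub)%VS.

Definition idK K : 'M[F]_n := \sum_(i in K) delta_mx i i.

Definition qK_center K : {vspace q} := <[T (idK K) 0]>%VS.

Lemma qK_gensP K (u : q) :
  reflect (exists i j b, [/\ i \in K, j \in K
             & u = if b then T 0 (delta_mx i j) else T (delta_mx i j) 0])
          (u \in qK_gens K).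
Proof.
rewrite mem_cat; apply: (iffP orP) => [[]/allpairsP[[i j] /= []]|].
- by rewrite !mem_enum => iK jK ->; exists i, j, false.
- by rewrite !mem_enum => iK jK ->; exists i, j, true.
move=> [i [j [b [iK jK ->]]]]; case: b; [right|left];
  by apply/allpairsP; exists (i, j); rewrite !mem_enum.
Qed.

Lemma qK_mem K i j b : i \in K -> j \in K ->
  (if b then T 0 (delta_mx i j) else T (delta_mx i j) 0) \in qK_sub K.
Proof. by move=> iK jK; apply/memv_span/qK_gensP; exists i, j, b. Qed.

Lemma T_addl A A' : T (A + A') 0 = T A 0 + T A' 0.
Proof. by have /= := T_lin 1 (A, 0) (A', 0); rewrite !scale1r addr0. Qed.

Lemma T_addr B B' : T 0 (B + B') = T 0 B + T 0 B'.
Proof. by have /= := T_lin 1 (0, B) (0, B'); rewrite !scale1r addr0. Qed.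

Lemma T0 : T 0 0 = 0.
Proof. by rewrite /T /Tmx block_mx0 linear0. Qed.

Lemma T_scale k A B : T (k *: A) (k *: B) = k *: T A B.
Proof. by have /= := T_lin k (A, B) (0, 0); rewrite !addr0 T0 addr0. Qed.

Lemma T_oppl A : T (- A) 0 = - T A 0.
Proof. by rewrite -!scaleN1r -T_scale scaler0. Qed.

Lemma T_oppr B : T 0 (- B) = - T 0 B.
Proof. by rewrite -!scaleN1r -T_scale scaler0. Qed.

Fact qK_subalgebra K : subalgebra (qK_sub K).
Proof.
split.
  apply: graded_span => u /qK_gensP[i [j [b [_ _ ->]]]].
  by case: b; [right; exact: T_odd | left; exact: T_even].
apply: br_span => u v /qK_gensP[i [j [b [iK jK ->]]]].
move=> /qK_gensP[k [l [c [kK lK ->]]]].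
have hl (c' a' : bool) : T (delta_mx i l *+ c') 0 \in qK_sub K /\
    T 0 (delta_mx k j *+ a') \in qK_sub K.
  split; first by case: c'; rewrite ?mulr0n ?mulr1n ?T0 ?mem0v //; apply: (@qK_mem K i l false).
  by case: a'; rewrite ?mulr0n ?mulr1n ?T0 ?mem0v //; apply: (@qK_mem K k j true).
have hr (c' a' : bool) : T 0 (delta_mx i l *+ c') \in qK_sub K /\
    T (delta_mx k j *+ a') 0 \in qK_sub K.
  split; first by case: c'; rewrite ?mulr0n ?mulr1n ?T0 ?mem0v //; apply: (@qK_mem K i l true).
  by case: a'; rewrite ?mulr0n ?mulr1n ?T0 ?mem0v //; apply: (@qK_mem K k j false).
have [[h1 h2] [h3 h4]] := (hl (j == k) (l == i), hr (j == k) (l == i)).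
case: b c => [] []; rewrite T_br !(mul0mx, mulmx0) !mul_delta_mx_cond;
  by rewrite ?(subr0, sub0r, addr0, add0r) ?T_addl ?T_addr ?T_oppl ?T_oppr;
     rewrite rpredD // rpredN.
Qed.

Fact sqK_subalgebra K : subalgebra (sqK_sub K).
Proof.
exact/subalgebra_cap/ideal_subalgebra/sq_ideal/qK_subalgebra.
Qed.

Lemma idK_mul K i j : i \in K -> j \in K ->
  idK K *m delta_mx i j = delta_mx i j /\ delta_mx i j *m idK K = delta_mx i j.
Proof.
move=> iK jK; split.
  rewrite /idK mulmx_suml (bigD1 i) //= big1 ?addr0 ?mul_delta_mx // => k.
  by case/andP=> _ /negPf ki; rewrite mul_delta_mx_cond ki.
rewrite /idK mulmx_sumr (bigD1 j) //= big1 ?addr0 ?mul_delta_mx // => k.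
by case/andP=> _ /negPf ki; rewrite mul_delta_mx_cond eq_sym ki.
Qed.

Lemma qK_center_sub K : (qK_center K <= qK_sub K)%VS.
Proof.
rewrite -memvE /idK; elim/big_rec: _ => [|i A iK]; first by rewrite T0 mem0v.
by rewrite T_addl => h; rewrite rpredD //; apply: (@qK_mem K i i false).
Qed.

Lemma qK_center_sub_sq K : (qK_center K <= sqK_sub K)%VS.
Proof.
rewrite subv_cap qK_center_sub -memvE mem_sq_sub oddpart_T.
by rewrite mxtrace0 eqxx.
Qed.

Lemma qK_center_comm K u : u \in qK_sub K ->
  br (T (idK K) 0) u = 0 /\ br u (T (idK K) 0) = 0.
Proof.
move=> Ku; split; apply/eqP; rewrite -memv0.
  apply: (@br_span _ _ [:: T (idK K) 0] (qK_gens K)) Ku; last first.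
    by apply: memv_span; rewrite mem_head.
  move=> v w /[!inE] /eqP -> /qK_gensP[i [j [b [iK jK ->]]]].
  have [e1 e2] := idK_mul iK jK.
  by case: b; rewrite T_br e1 e2 !(mul0mx, mulmx0) !subrr !addr0 T0 mem0v.
apply: (@br_span _ _ (qK_gens K) [:: T (idK K) 0]) Ku _; last first.
  by apply: memv_span; rewrite mem_head.
move=> w v /qK_gensP[i [j [b [iK jK ->]]]] /[!inE] /eqP ->.
have [e1 e2] := idK_mul iK jK.
by case: b; rewrite T_br e1 e2 !(mul0mx, mulmx0) !subrr !addr0 T0 mem0v.
Qed.

Lemma qK_center_graded K : graded (qK_center K).
Proof.
apply: gradedP => u hu; exists u, 0; rewrite !mem0v addr0; split=> //.
by case/vlineP: hu => k ->; rewrite rpredZ ?T_even.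
Qed.

Fact qK_center_ideal K : ideal_in (qK_sub K) (qK_center K).
Proof.
split; [exact: qK_center_graded | exact: qK_center_sub |].
move=> u v Ku /vlineP[k ->]; have [e1 e2] := qK_center_comm Ku.
by rewrite (linfZ (br_linl _)) (linfZ (br_linr _)) e1 e2 !scaler0 mem0v.
Qed.

Fact sqK_center_ideal K : ideal_in (sqK_sub K) (qK_center K).
Proof.
have [h1 _ h3] := qK_center_ideal K.
split; [exact: h1 | exact: qK_center_sub_sq |].
by move=> u v /memv_capP[Ku _]; exact: h3.
Qed.

Lemma q_center_sub_sq : (q_center <= sq_sub)%VS.
Proof. by rewrite -memvE mem_sq_sub oddpart_T mxtrace0 eqxx. Qed.

Definition qK K : lieSuper F := subLie (qK_subalgebra K).
Definition pqK K : lieSuper F := quoLie (qK_subalgebra K) (qK_center_ideal K).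
Definition psqK K : lieSuper F :=
  quoLie (sqK_subalgebra K) (sqK_center_ideal K).

Definition sq : derAlg q := quoAlg sq_ideal (ideal_in0 fullv) (sub0v _).
Definition pq : derAlg q := quoAlg (ideal_inT q) q_center_ideal (subvf _).
Definition psq : derAlg q := quoAlg sq_ideal q_center_ideal q_center_sub_sq.

(* The natural module of column vectors [col_mx v0 v1], with [v0] even and [v1]
   odd. *)
Definition std_par (b : bool) : {vspace 'cV[F]_(n + n)} :=
  if b then lker (linfun usubmx) else lker (linfun dsubmx).

Lemma std_parE b (v : 'cV[F]_(n + n)) :
  (v \in std_par b) = ((if b then usubmx v else dsubmx v) == 0).
Proof.
by case: b; rewrite memv_ker linfun_funE // => k u w;
  apply/matrixP=> i j; rewrite !mxE.
Qed.

Fact std_full : (std_par false + std_par true)%VS = fullv.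
Proof.
apply/eqP; rewrite eqEsubv subvf /=; apply/subvP=> v _.
rewrite -[v]vsubmxK -[col_mx _ _]addr0.
have -> : col_mx (usubmx v) (dsubmx v) + 0
    = col_mx (usubmx v) 0 + col_mx 0 (dsubmx v).
  by rewrite add_col_mx !addr0 add0r.
by rewrite memv_add ?(std_parE false) ?(std_parE true) /= ?col_mxKu ?col_mxKd.
Qed.

Fact std_direct : (std_par false :&: std_par true)%VS = 0%VS.
Proof.
apply/eqP; rewrite -subv0; apply/subvP=> v /memv_capP[].
rewrite !std_parE /= => /eqP h0 /eqP h1.
by rewrite memv0 -[v]vsubmxK h0 h1 col_mx0.
Qed.

Definition std_space : superSpace F := SuperSpace std_full std_direct.

Definition std_act (u : q) (v : std_space) : std_space := vsval u *m v.

Lemma Tmx_mul A B (v : 'cV[F]_(n + n)) :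
  Tmx A B *m v = col_mx (A *m usubmx v + B *m dsubmx v)
                        (B *m usubmx v + A *m dsubmx v).
Proof. by rewrite -{1}[v]vsubmxK mul_block_col. Qed.

Fact std_rep : is_rep std_act.
Proof.
split.
- by move=> v k u u'; rewrite /std_act linearP mulmxDl -scalemxAl.
- by move=> u k v v'; rewrite /std_act mulmxDr -scalemxAr.
- move=> a b u v; rewrite mem_qpar mem_gl_par ![_ \in _]std_parE.
  rewrite /std_act (T_surj u) val_T Tmx_mul.
  rewrite /gl_part /Tmx !(block_mxKul, block_mxKur, block_mxKdl, block_mxKdr).
  rewrite col_mxKu col_mxKd => /eqP h.
  have z : (if a then evenpart u else oddpart u) = 0.
    by case: a h => /= /(congr1 (fun X => (ulsubmx X, ursubmx X)));
      rewrite block_mxKul block_mxKur -[0 in RHS]block_mx0 block_mxKul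
        block_mxKur => -[].
  by case: a z {h} => ->; case: b => /= /eqP ->;
    rewrite ?mul0mx ?mulmx0 ?addr0 ?add0r.
- move=> a b u v w; rewrite !mem_qpar => pu pv; rewrite /std_act.
  have -> : vsval (br u v : q) = br (vsval u : gl F n n) (vsval v).
    rewrite (T_surj u) (T_surj v) T_br !val_T; exact/esym/Tmx_br.
  by rewrite /= (gl_brE pu pv) mulmxBl -scalemxAl !mulmxA.
Qed.

Definition stdMod : superMod q := SuperMod std_rep.

End Queer.

Section StandardEmbedding.
Variables (F : numClosedFieldType) (m n : nat) (e : 'I_m -> 'I_n).

Definition mx_incl (A : 'M[F]_m) : 'M[F]_n :=
  \sum_i \sum_j A i j *: delta_mx (e i) (e j).

(* For injective [e] with image [K], the embedding of [q_m] onto [q(K)]. *)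
Definition q_incl (u : q F m) : q F n :=
  T (mx_incl (evenpart u)) (mx_incl (oddpart u)).

Definition qK_incl (K : {set 'I_n}) : 'Hom(q F m, qK F K) :=
  linfun (fun u => qproj (qK_sub F K) 0 (q_incl u)).

End StandardEmbedding.

Section Identification.
Variables (F : numClosedFieldType) (g : lieSuper F) (x : odd_part g).
Variable A : derAlg g.

Definition invariants : {vspace A} := lker (act_end x A).

Definition image_invariants : {vspace A} :=
  (limg (act_end x A) :&: invariants)%VS.

(* [A^x = k |>< ([x, A] :&: A^x)]. *)
Definition DS_complement (k : {vspace A}) : Prop :=
  [/\ subalgebra k, ideal_in invariants image_invariants,
      (k + image_invariants)%VS = invariants
    & (k :&: image_invariants)%VS = 0%VS].

Definition DSlie_proj : 'Hom(A, DSlie x A) := qproj (dsKer x A) (dsIm x A).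

(* The image of [S] in [A] consists of [x]-invariants, and sending the class in
   [k] of an element of [S] to its class in [DS_x(A)] is a well-defined
   isomorphism [k -> DS_x(A)]. With [S = q(K)] and [k = pq(K)] this is the sense
   in which [DS_x(pq_n)] is identified with [pq(K) = q(K) / C T_{Id_K,0}] (and
   similarly for [psq]). [DS_complement] does not apply there: if [K] is proper
   and non-empty, the class of [T_{Id_K,0}] in [pq_n] is non-zero but belongs to
   [[x, pq_n]], so [pq(K)] is not a subalgebra of [pq_n], and [pq_n^x] need not contain any
   subalgebra complementary to [[x, pq_n] :&: pq_n^x]: for [n = 2] and [x = H_2]
   its odd part is spanned by [H_1], whose square [T_{E_11,0}] is not zero. *)
Definition DS_canonical_iso (S : {vspace g}) (k : lieSuper F)
    (p : 'Hom(g, k)) (i : 'Hom(g, A)) : Prop :=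
  exists2 psi : 'Hom(k, DSlie x A), lie_iso psi
    & forall u, u \in S ->
        i u \in invariants /\ psi (p u) = DSlie_proj (i u).

End Identification.
Arguments DS_complement {F g} x A k.
Arguments DS_canonical_iso {F g} x A S k p i.

Section OneDimensional.
Variable F : numClosedFieldType.

Fact parity_change_full (V : superSpace F) :
  (par (~~ false) + par (~~ true) : {vspace V})%VS = fullv.
Proof. by rewrite addvC par_full. Qed.

Fact parity_change_direct (V : superSpace F) :
  (par (~~ false) :&: par (~~ true) : {vspace V})%VS = 0%VS.
Proof. by rewrite capvC par_direct. Qed.

Definition parity_change (V : superSpace F) : superSpace F :=
  @SuperSpace F V (fun b => par (~~ b))
    (parity_change_full V) (parity_change_direct V).

Definition line_par (b : bool) : {vspace F^o} := if b then 0%VS else fullv.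

Fact line_par_full : (line_par false + line_par true)%VS = fullv.
Proof. exact: addv0. Qed.

Fact line_par_direct : (line_par false :&: line_par true)%VS = 0%VS.
Proof. exact: capv0. Qed.

Definition line : superSpace F := SuperSpace line_par_full line_par_direct.

Section Abelian.
Variable V : superSpace F.
Let b0 : V -> V -> V := fun _ _ => 0.

Fact abelian_linl (v : V) : linear (b0^~ v).
Proof. by move=> k a b; rewrite /b0 scaler0 addr0. Qed.

Fact abelian_linr (v : V) : linear (b0 v).
Proof. by move=> k a b; rewrite /b0 scaler0 addr0. Qed.

Fact abelian_par i j (u v : V) :
  u \in par i -> v \in par j -> b0 u v \in par (i (+) j).
Proof. by rewrite /b0 mem0v. Qed.

Fact abelian_anti i j (u v : V) : u \in par i -> v \in par j ->
  b0 u v = - ((-1) ^+ (i && j) *: b0 v u).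
Proof. by rewrite /b0 scaler0 oppr0. Qed.

Fact abelian_jacobi i j (u v w : V) : u \in par i -> v \in par j ->
  b0 u (b0 v w) = b0 (b0 u v) w + (-1) ^+ (i && j) *: b0 v (b0 u w).
Proof. by rewrite /b0 scaler0 addr0. Qed.

Definition abelianLie : lieSuper F :=
  LieSuper abelian_linl abelian_linr abelian_par abelian_anti abelian_jacobi.

End Abelian.
End OneDimensional.

Section Rank.
Variables (F : numClosedFieldType) (n : nat).

Definition odd_semisimple (x : odd_part (q F n)) : Prop :=
  lsemisimple (linfun (br (br (vsval x) (vsval x)))).

(* [F] is algebraically closed, so semisimple means diagonalizable. *)
Definition jordan_chevalley (B Bss Bnil : 'M[F]_n) : Prop :=
  [/\ B = Bss + Bnil, diagonalizable Bss, exists k, Bnil ^+ k = 0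
    & Bss *m Bnil = Bnil *m Bss].

Definition has_rank (x : odd_part (q F n)) (rk : rat) : Prop :=
  exists Bss Bnil, jordan_chevalley (oddpart (vsval x)) Bss Bnil
    /\ rk = (\rank Bnil)%:R + 2^-1 * (\rank Bss)%:R.

Definition is_nil_part (x : odd_part (q F n)) (y : q F n) : Prop :=
  exists Bss Bnil, jordan_chevalley (oddpart (vsval x)) Bss Bnil
    /\ y = T 0 Bnil.

End Rank.

(* Main.v *)
Require Import Defs.
From HB Require Import structures.
From mathcomp Require Import all_boot all_order all_algebra.
From mathcomp Require Import ring zify.
From mathcomp Require Import reals complex.

Set Implicit Arguments.
Unset Strict Implicit.
Unset Printing Implicit Defensive.

Import GRing.Theory Num.Theory.
Local Open Scope ring_scope.

(** Write [x = T 0 X] and let [P] be the idempotent [idK (~: J)]. Transposing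
    the pairs of the nilpotent part, inverting their coefficients, and replacing
    each [c_i] by [1 / (2 c_i)] gives a matrix [Y] with [X Y + Y X = 1 - P] and
    [P X = X P = 0]. On [ker (ad x)], the map
    [T A B |-> T (Y B - P B Y) (Y A + P A Y)] is a homotopy between the identity
    and the truncation [u |-> P u P], which yields (i), (ii) and (iii).
    If [J] is everything, then [P = 0] and [ad x] is exact on [q_n]; the homology
    of [sq_n], [pq_n] and [psq_n] is detected by the functionals
    [chi (T A B) = tr (Y A)] and [lambda (T A B) = (2 / n) tr (X B)], for which
    [chi [x, w]] is the odd trace of [w], [chi (T 1 0) = tr Y] and
    [chi [u, v] = 2 lambda u lambda v tr (Y ^ 3)]. Finally [tr Y] and [tr (Y ^ 3)]
    are [1/2] and [1/8] times the sums of the [c_i ^ -1] and [c_i ^ -3]. *)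

(** The anticommutator enters because [x] is odd: [[x, T 0 Y] = T (X Y + Y X) 0 = T (1 - P) 0]. The
    obstacle is that passing from [q_n] to a subquotient [U / I] changes the homology at both ends:
    a cycle only satisfies [[x, u] \in I], and a boundary needs a primitive in [U]. If [J] is
    proper, both defects disappear. Compression by [P] shows that [[x, u]] is never a non-zero
    multiple of [T 1 0], and the odd trace of a primitive is corrected by some [T 0 E_kk] with [k]
    outside [J], which [ad x] kills. If [J] is everything, both defects create homology. Modulo the
    centre, [T 0 Y] becomes an odd cycle. In [sq_n] the even cycle [T X 0] stops being a boundary,
    since its primitives have odd trace [tr (Y X) = n / 2]; this value also explains the factor
    [2 / n]. For [psq_n] the number [tr Y] decides everything: it is the odd trace of [T 0 Y] and
    the value of [chi] on [T 1 0], so both classes exist exactly when it vanishes. The cube of [Y]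
    then measures the square of the odd class. *)

(** * Isomorphisms of Lie superalgebras and quotients *)

Lemma lfun_bijective (F : fieldType) (V W : vectType F) (f : 'Hom(V, W)) :
  (forall u, f u = 0 -> u = 0) -> (forall w, exists u, f u = w) -> bijective f.
Proof.
move=> f0 fonto; exists (f^-1)%VF => [u | w].
  apply: lker0_lfunK; rewrite -subv0; apply/subvP=> v.
  by rewrite memv_ker memv0 => /eqP/f0 ->.
by have [u <-] := fonto w; rewrite limg_lfunVK ?memv_img ?memvf.
Qed.

Section LieIsomorphisms.
Variable F : numClosedFieldType.

(** Parity passes to the inverse because the component of wrong parity of a preimage has an image
    that is both even and odd, hence zero. *)
Lemma lie_iso_inverse (g h : lieSuper F) (f : 'Hom(g, h)) : lie_iso f ->
  exists2 f' : 'Hom(h, g), lie_iso f' & cancel f f'.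
Proof.
move=> [[fpar fbr] fbij].
have finj := bij_inj fbij.
have fK' : cancel (f^-1)%VF f.
  move=> y; case: fbij => f0 _ fK0; apply: limg_lfunVK.
  by rewrite -(fK0 y) memv_img ?memvf.
have fK : cancel f (f^-1)%VF by move=> y; apply: finj; rewrite fK'.
exists (f^-1)%VF => //; split; last by exists f.
split=> [a y py | y z]; last by apply: finj; rewrite fbr !fK'.
have [u0 [u1 [p0 p1 e]]] := par_split ((f^-1)%VF y).
have ey : y = f u0 + f u1 by rewrite -linearD -e; exact/esym/fK'.
have [q0 q1] := (fpar _ _ p0, fpar _ _ p1).
have z0 (u : g) : f u = 0 -> u = 0 by move=> fu; apply: finj; rewrite fu linear0.
case: a py => py.
  rewrite e (z0 u0) ?add0r //; apply: (@par_disj _ _ _ false) => //=.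
  by rewrite (_ : f u0 = y - f u1) ?rpredB // ey addrK.
rewrite e (z0 u1) ?addr0 //; apply: (@par_disj _ _ _ true) => //=.
by rewrite (_ : f u1 = y - f u0) ?rpredB // ey addrC addKr.
Qed.

Lemma lie_iso_sdim (g h : lieSuper F) (f : 'Hom(g, h)) : lie_iso f ->
  forall b, \dim (par b : {vspace g}) = \dim (par b : {vspace h}).
Proof.
move=> isof b; have [f' [[f'par _] _] fK] := lie_iso_inverse isof.
have [[fpar _] fbij] := isof.
have f'K : cancel f' f by move=> y; case: fbij => f0 _ fK0; rewrite -(fK0 y) fK.
have kf : (par b :&: lker f)%VS = 0%VS.
  apply/eqP; rewrite -subv0; apply/subvP=> u /memv_capP[_].
  rewrite memv_ker => /eqP e; rewrite memv0; apply/eqP/(bij_inj fbij).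
  by rewrite e linear0.
rewrite -(limg_dim_eq kf); congr (\dim _); apply/eqP; rewrite eqEsubv.
apply/andP; split; apply/subvP=> y; first by case/memv_imgP=> u pu ->; apply: fpar.
by move=> py; rewrite -(f'K y) memv_img // f'par.
Qed.

Section QuotientMap.
Variables (g h : lieSuper F) (U I : {vspace g}).
Variables (hU : subalgebra U) (hI : ideal_in U I) (f : 'Hom(g, h)).
Hypotheses (f_ker : forall u, u \in U -> f u = 0 <-> u \in I)
  (f_onto : forall v, exists2 u, u \in U & f u = v)
  (f_par : forall a u, u \in U -> u \in par a -> f u \in par a)
  (f_br : forall u v, u \in U -> v \in U -> f (br u v) = br (f u) (f v)).

(** The first isomorphism theorem in a form suited to quotients realised on a complement: [f] lives
    on all of [g], its properties are required on [U] only, and [psi] evaluates it at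
    representatives. *)
Lemma quo_lie_iso : exists2 psi : 'Hom(quoLie hU hI, h),
  lie_iso psi & forall u, u \in U -> psi (qproj U I u) = f u.
Proof.
have [gU _] := hU; have [gI IU _] := hI.
have lpsi : linear (fun a : quoLie hU hI => f (vsval a)).
  by move=> k a b; rewrite !linearP.
have fq u : u \in U -> f (vsval (qproj U I u)) = f u.
  move=> Uu; apply/esym/eqP; rewrite -subr_eq0 -linearB; apply/eqP.
  by rewrite f_ker ?(subvP IU) // qproj_sub.
exists (linfun (fun a : quoLie hU hI => f (vsval a))); last first.
  by move=> u Uu; rewrite (linfun_funE lpsi) fq.
have vU (a : quoLie hU hI) : vsval a \in U by apply: qval_in.
split; last first.
  apply: lfun_bijective => [a | v].
    rewrite (linfun_funE lpsi) => /(f_ker (vU a)) Ia.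
    by rewrite -[a](qproj_val gI); apply/eqP; rewrite qproj_eq0.
  have [u Uu fu] := f_onto v.
  by exists (qproj U I u); rewrite (linfun_funE lpsi) fq.
split=> [b a | a b]; rewrite !(linfun_funE lpsi); last first.
  by rewrite [br a b]/(quo_br a b) /quo_br fq ?f_br //; apply: hU.2; apply: vU.
by rewrite [_ \in _]mem_qpar => pa; apply: f_par.
Qed.

End QuotientMap.
End LieIsomorphisms.

(** * The homology of a subquotient of the adjoint module *)

Lemma mem_dsKer_alg (F : numClosedFieldType) (g : lieSuper F)
    (x : odd_part g) (A : derAlg g) (u : A) :
  (u \in dsKer x A) = (da_act (vsval x) u == 0).
Proof. exact: mem_dsKer. Qed.

Section QuotientAlgebra.
Variables (F : numClosedFieldType) (g : lieSuper F) (U I : {vspace g}).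
Variables (hU : ideal_in fullv U) (hI : ideal_in fullv I) (IU : (I <= U)%VS).
Variable x : odd_part g.

Local Notation A := (quoAlg hU hI IU).
Local Notation X := (br (vsval x)).

Let gU : graded U. Proof. by case: hU. Qed.
Let gI : graded I. Proof. by case: hI. Qed.

Let XU u : u \in U -> X u \in U.
Proof. by case: hU => _ _ h Uu; case: (h (vsval x) u (memvf _) Uu). Qed.

Let XI u : u \in I -> X u \in I.
Proof. by case: hI => _ _ h Uu; case: (h (vsval x) u (memvf _) Uu). Qed.

Lemma quoAlg_actE u : u \in U ->
  da_act (vsval x) (qproj U I u : A) = qproj U I (X u).
Proof.
move=> Uu; apply/esym/qproj_eq => //; first exact: XU.
by rewrite /= -(linfB (br_linr _)) XI // qproj_sub.
Qed.

Lemma mem_dsKer_quoAlg u : u \in U ->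
  ((qproj U I u : A) \in dsKer x A) = (X u \in I).
Proof. move=> Uu; rewrite mem_dsKer_alg quoAlg_actE //.
by rewrite qproj_eq0 // XU. Qed.

Lemma mem_dsIm_quoAlg u : u \in U ->
  (qproj U I u : A) \in dsIm x A <->
  exists w, [/\ w \in U, X (X w) \in I & u - X w \in I].
Proof.
move=> Uu; split.
  move=> /dsImP[a /= e ea]; exists (vsval a).
  have Ua : vsval a \in U by apply: qval_in.
  have E1 : da_act (vsval x) a = qproj U I (X (vsval a)).
    by rewrite -(quoAlg_actE Ua) qproj_val.
  have E2 : da_act (vsval x) (da_act (vsval x) a) = qproj U I (X (X (vsval a))).
    by rewrite E1 quoAlg_actE ?XU.
  split=> //.
    by rewrite -(qproj_eq0 gU gI IU) ?XU // -E2; apply/eqP.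
  rewrite -(qproj_eq0 gU gI IU) ?rpredB ?XU // linearB subr_eq0.
  by apply/eqP; apply: etrans ea E1.
case=> w [Uw e d]; apply/dsImP; exists (qproj U I w : A) => /=.
  transitivity (da_act (vsval x) (qproj U I (X w) : A)).
    by rewrite -(quoAlg_actE Uw).
  by rewrite quoAlg_actE ?XU //; apply/eqP; rewrite qproj_eq0 ?XU.
rewrite -[RHS]/(da_act (vsval x) (qproj U I w : A)) quoAlg_actE //.
exact: qproj_eq.
Qed.

Variables (h : lieSuper F) (f : 'Hom(g, h)).
Hypotheses
  (f_ker : forall u, u \in U -> X u \in I ->
     (f u = 0 <-> exists w, [/\ w \in U, X (X w) \in I & u - X w \in I]))
  (f_onto : forall v, exists u, [/\ u \in U, X u \in I & f u = v])
  (f_par : forall a u, u \in U -> X u \in I -> u \in par a -> f u \in par a)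
  (f_br : forall u v, u \in U -> X u \in I -> v \in U -> X v \in I ->
     f (br u v) = br (f u) (f v)).

(** All conditions are stated on representatives in [g], so that the homology of [sq], [pq] and
    [psq] can be read off from one linear map on [q_n]. Cycles are taken modulo [I], and primitives
    in [U]. *)
Lemma DS_quoAlg_iso : exists2 psi : 'Hom(DSlie x A, h), lie_iso psi
  & forall u, u \in U -> X u \in I ->
      psi (DSlie_proj x A (qproj U I u)) = f u.
Proof.
(* An element of [I] is a boundary modulo [I] with primitive 0, so [f] descends to the quotient. *)
have f0 u : u \in I -> f u = 0.
  move=> Iu; apply/(f_ker (subvP IU _ Iu) (XI Iu)); exists 0.
  by rewrite !(linf0 (br_linr _)) subr0 !mem0v.
have lfv : linear (fun a : A => f (vsval a)) by move=> k a b; rewrite !linearP.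
pose fA : 'Hom(A, h) := linfun (fun a : A => f (vsval a)).
have fE u : u \in U -> fA (qproj U I u) = f u.
  move=> Uu; rewrite (linfun_funE lfv); apply/esym/eqP.
  by rewrite -subr_eq0 -linearB; apply/eqP/f0/qproj_sub.
have vU (a : A) : vsval a \in U by apply: qval_in.
have qv (a : A) : a = qproj U I (vsval a) by rewrite qproj_val.
have kv (a : A) : (a \in dsKer x A) = (X (vsval a) \in I).
  by rewrite {1}[a]qv mem_dsKer_quoAlg.
have [] := @quo_lie_iso F A h (dsKer x A) (dsIm x A)
  (dsKer_subalgebra x A) (dsIm_ideal x A) fA.
- move=> a; rewrite kv => Ka; rewrite [a]qv fE // mem_dsIm_quoAlg //.
  exact: f_ker.
- move=> v; have [u [Uu Ku <-]] := f_onto v.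
  by exists (qproj U I u : A); rewrite ?mem_dsKer_quoAlg ?fE.
- move=> b a; rewrite kv => Ka; rewrite [_ \in par _]mem_qpar => pa.
  by rewrite [a]qv fE // f_par.
- move=> a b; rewrite !kv => Ka Kb.
  rewrite [br a b]/(quo_br a b) /quo_br fE; last first.
    by case: hU => _ _ H'; case: (H' (vsval a) (vsval b) (memvf _) (vU b)).
  by rewrite {2}[a]qv {2}[b]qv !fE // f_br.
- move=> psi isopsi psiE; exists psi => // u Uu Ku.
  by rewrite psiE ?mem_dsKer_quoAlg // fE.
Qed.

End QuotientAlgebra.

(** * Coordinates on the queer superalgebra and compression to a set of indices *)

Section QueerMatrices.
Variables (F : numClosedFieldType) (n : nat).
Implicit Types (u v w : q F n) (A B X Y Z : 'M[F]_n) (K : {set 'I_n}).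

Lemma evenpart_lin : linear (@evenpart F n).
Proof. by move=> k u v; rewrite /evenpart; apply/matrixP=> i j; rewrite !mxE. Qed.

Lemma oddpart_lin : linear (@oddpart F n).
Proof. by move=> k u v; rewrite /oddpart; apply/matrixP=> i j; rewrite !mxE. Qed.

Lemma q_ext u v :
  evenpart u = evenpart v -> oddpart u = oddpart v -> u = v.
Proof. by move=> e o; rewrite (T_surj u) (T_surj v) e o. Qed.

Lemma T_add A B A' B' : T A B + T A' B' = T (A + A') (B + B').
Proof. by have := T_lin 1 (A, B) (A', B'); rewrite /= !scale1r => ->. Qed.

Lemma T_opp A B : - T A B = T (- A) (- B).
Proof. by rewrite -scaleN1r -T_scale !scaleN1r. Qed.

Lemma evenpartD u v : evenpart (u + v) = evenpart u + evenpart v.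
Proof. exact: (linfD evenpart_lin). Qed.

Lemma evenpartZ k u : evenpart (k *: u) = k *: evenpart u.
Proof. exact: (linfZ evenpart_lin). Qed.

Lemma oddpartD u v : oddpart (u + v) = oddpart u + oddpart v.
Proof. exact: (linfD oddpart_lin). Qed.

Lemma oddpartB u v : oddpart (u - v) = oddpart u - oddpart v.
Proof. exact: (linfB oddpart_lin). Qed.

Lemma oddpartZ k u : oddpart (k *: u) = k *: oddpart u.
Proof. exact: (linfZ oddpart_lin). Qed.

Lemma evenpart0 : evenpart (0 : q F n) = 0.
Proof. exact: (linf0 evenpart_lin). Qed.

Lemma oddpart0 : oddpart (0 : q F n) = 0.
Proof. exact: (linf0 oddpart_lin). Qed.

Lemma mem_qpar_parts b u :
  (u \in par b) = ((if b then evenpart u else oddpart u) == 0).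
Proof.
rewrite {1}(T_surj u); move: (evenpart u) (oddpart u) => A B.
rewrite mem_qpar mem_gl_par /gl_part val_T.
rewrite !(block_mxKul, block_mxKur, block_mxKdl, block_mxKdr).
apply/eqP/eqP; last by case: b => /= ->; rewrite block_mx0.
by case: b => /=; rewrite -(block_mx0 F n n n n) => /eq_block_mx[].
Qed.

Lemma evenpart_br u v : evenpart (br u v) =
  evenpart u *m evenpart v - evenpart v *m evenpart u
  + (oddpart u *m oddpart v + oddpart v *m oddpart u).
Proof. by rewrite {1}(T_surj u) {1}(T_surj v) T_br evenpart_T. Qed.

Lemma oddpart_br u v : oddpart (br u v) =
  evenpart u *m oddpart v - oddpart v *m evenpart u
  + (oddpart u *m evenpart v - evenpart v *m oddpart u).
Proof. by rewrite {1}(T_surj u) {1}(T_surj v) T_br oddpart_T. Qed.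

Lemma q_centerP u :
  reflect (exists k, evenpart u = k%:M /\ oddpart u = 0) (u \in q_center F n).
Proof.
apply: (iffP idP) => [/vlineP[k ->]|[k [e o]]]; last apply/vlineP; exists k.
  by rewrite evenpartZ oddpartZ evenpart_T oddpart_T scaler0 scalemx1.
by apply: q_ext; rewrite ?e ?o (evenpartZ, oddpartZ) ?evenpart_T ?oddpart_T
  ?scaler0 ?scalemx1.
Qed.

Lemma mxtrace_delta i j : \tr (delta_mx i j : 'M[F]_n) = (i == j)%:R.
Proof.
rewrite /mxtrace (bigD1 i) //= big1 ?addr0 ?mxE ?eqxx // => k /negPf ki.
by rewrite mxE ki.
Qed.

Lemma idK_diag K : idK F K = diag_mx (\row_i (i \in K)%:R).
Proof.
rewrite diag_mx_sum_delta /idK [RHS](bigID (mem K)) /= [X in _ + X]big1 ?addr0.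
  by apply: eq_bigr => i iK; rewrite mxE iK scale1r.
by move=> i iK; rewrite mxE (negPf iK) scale0r.
Qed.

Lemma idK_idem K : idK F K *m idK F K = idK F K.
Proof.
rewrite idK_diag mul_diag_mx; apply/matrixP=> i j; rewrite !mxE.
by case: (i \in K); rewrite ?mul1r // mul0rn mul0r.
Qed.

Lemma idKC K : idK F (~: K) = 1%:M - idK F K.
Proof.
rewrite !idK_diag -diag_const_mx -linearB; congr diag_mx.
by apply/rowP=> i; rewrite !mxE inE; case: (i \in K); rewrite ?subrr ?subr0.
Qed.

Lemma idK0 : idK F (set0 : {set 'I_n}) = 0.
Proof. by rewrite /idK big_set0. Qed.

Lemma trunc_lin K :
  linear (fun u => T (idK F K *m evenpart u *m idK F K)
                     (idK F K *m oddpart u *m idK F K)).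
Proof.
move=> k u v; apply: q_ext;
  rewrite ?(evenpartD, evenpartZ, evenpart_T, oddpartD, oddpartZ, oddpart_T);
  by rewrite mulmxDr mulmxDl -scalemxAr -scalemxAl.
Qed.

(** In general this is only a linear projection onto [q(K)]; it respects brackets on the kernel of
    [ad x] ([trunc_br]). *)
Definition trunc K : 'End(q F n) :=
  linfun (fun u => T (idK F K *m evenpart u *m idK F K)
                     (idK F K *m oddpart u *m idK F K)).

Lemma truncE K u : trunc K u = T (idK F K *m evenpart u *m idK F K)
                                 (idK F K *m oddpart u *m idK F K).
Proof. exact: (linfun_funE (trunc_lin K)). Qed.

(** [qK_sub] is a span of matrix units, so membership of a compression needs this expansion. *)
Lemma idK_sandwich K A : idK F K *m A *m idK F K
  = \sum_(i in K) \sum_(j in K) A i j *: delta_mx i j.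
Proof.
rewrite idK_diag mul_diag_mx mul_mx_diag; apply/matrixP=> i j.
rewrite !mxE summxE (bigID (pred1 i)) /= [X in _ + X]big1 ?addr0; last first.
  move=> k /andP[_ ki]; rewrite summxE big1 // => l _.
  by rewrite !mxE eq_sym (negPf ki) mulr0.
case iK: (i \in K); last first.
  rewrite !mul0r big_pred0 // => k.
  by case: (eqVneq k i) => [->|_]; rewrite ?iK ?andbF.
rewrite (big_pred1 i); last first.
  by move=> k /=; case: (eqVneq k i) => [->|_]; rewrite ?iK ?andbF.
rewrite summxE (bigID (pred1 j)) /= [X in _ + X]big1 ?addr0; last first.
  by move=> l /andP[_ lj]; rewrite !mxE [j == _]eq_sym (negPf lj) andbF mulr0.
case jK: (j \in K); last first.
  rewrite mulr0 big_pred0 // => l.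
  by case: (eqVneq l j) => [->|_]; rewrite ?jK ?andbF.
rewrite (big_pred1 j); last first.
  by move=> l /=; case: (eqVneq l j) => [->|_]; rewrite ?jK ?andbF.
by rewrite !mxE !eqxx !mulr1 mul1r.
Qed.

Lemma trunc_in K u : trunc K u \in qK_sub F K.
Proof.
rewrite truncE T_split; set A := evenpart u; set B := oddpart u.
rewrite !idK_sandwich rpredD //.
  elim/big_rec: _ => [|i C iK hC]; first by rewrite T0 mem0v.
  rewrite T_addl rpredD //; elim/big_rec: _ => [|j D jK hD]; first by rewrite T0 mem0v.
  rewrite T_addl rpredD // -[0](scaler0 _ (A i j)) T_scale rpredZ //.
  exact: (@qK_mem _ _ K i j false).
elim/big_rec: _ => [|i C iK hC]; first by rewrite T0 mem0v.
rewrite T_addr rpredD //; elim/big_rec: _ => [|j D jK hD]; first by rewrite T0 mem0v.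
rewrite T_addr rpredD // -[0](scaler0 _ (B i j)) T_scale rpredZ //.
exact: (@qK_mem _ _ K i j true).
Qed.

Lemma trunc_id K u : u \in qK_sub F K -> trunc K u = u.
Proof.
move=> Ku; apply/eqP; rewrite -subr_eq0.
have : (qK_sub F K <= lker (trunc K - \1%VF))%VS.
  apply/span_subvP => v /qK_gensP[i [j [b [iK jK ->]]]].
  rewrite memv_ker add_lfunE opp_lfunE id_lfunE truncE subr_eq0; apply/eqP.
  have [e1 e2] := idK_mul F iK jK.
  by case: b; rewrite evenpart_T oddpart_T mulmx0 mul0mx e1 e2.
by move/subvP/(_ u Ku); rewrite memv_ker add_lfunE opp_lfunE id_lfunE.
Qed.

Lemma trunc_par K b u : u \in par b -> trunc K u \in par b.
Proof.
rewrite !mem_qpar_parts truncE evenpart_T oddpart_T.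
by case: b => /eqP ->; rewrite mulmx0 mul0mx.
Qed.

Lemma std_actE (u : q F n) (v : stdMod F n) : act u v =
  col_mx (evenpart u *m usubmx v + oddpart u *m dsubmx v)
         (oddpart u *m usubmx v + evenpart u *m dsubmx v).
Proof. by rewrite /act /= /std_act {1}(T_surj u) val_T Tmx_mul. Qed.

End QueerMatrices.

(** * The contracting homotopy and the homology of the adjoint module *)

Section Homotopy.
Variables (F : numClosedFieldType) (n : nat) (X Y : 'M[F]_n).
Variables (K : {set 'I_n}) (x : odd_part (q F n)).
Implicit Types (u v w : q F n) (A B Z : 'M[F]_n).
Local Notation P := (idK F K).
Hypotheses (xE : vsval x = T 0 X).
Hypotheses (PX : P *m X = 0) (XP : X *m P = 0).
Hypothesis XY : X *m Y + Y *m X = 1%:M - P.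

Lemma adxE u : br (vsval x) u =
  T (X *m oddpart u + oddpart u *m X) (X *m evenpart u - evenpart u *m X).
Proof.
rewrite xE {1}(T_surj u) T_br !mul0mx !mulmx0 !subr0 add0r.
by rewrite add0r.
Qed.

Lemma adx_kerP u : br (vsval x) u = 0 <->
  X *m evenpart u = evenpart u *m X /\ X *m oddpart u = - (oddpart u *m X).
Proof.
rewrite adxE; split=> [e | [-> ->]]; last by rewrite addNr subrr T0.
have := congr1 (@evenpart F n) e; have := congr1 (@oddpart F n) e.
rewrite evenpart_T oddpart_T evenpart0 oddpart0 => /eqP; rewrite subr_eq0 => /eqP ->.
by move/eqP; rewrite addr_eq0 => /eqP ->.
Qed.

Lemma br1 u : br u (T 1%:M 0) = 0.
Proof. by case: (T1_central u). Qed.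

Lemma adxZ1 k : br (vsval x) (k *: T 1%:M 0) = 0.
Proof. by rewrite (linfZ (br_linr _)) br1 scaler0. Qed.

Lemma trunc_adx w : trunc F K (br (vsval x) w) = 0.
Proof.
rewrite truncE adxE evenpart_T oddpart_T.
have l Z : P *m (X *m Z) *m P = 0 by rewrite mulmxA PX !mul0mx.
have r Z : P *m (Z *m X) *m P = 0 by rewrite -!mulmxA XP !mulmx0.
by rewrite mulmxDr mulmxBr mulmxDl mulmxBl !l !r addr0 subr0 T0.
Qed.

Lemma adx_trunc u : br (vsval x) (trunc F K u) = 0.
Proof.
apply/adx_kerP; rewrite truncE evenpart_T oddpart_T.
have l Z : X *m (P *m Z *m P) = 0 by rewrite !mulmxA XP !mul0mx.
have r Z : P *m Z *m P *m X = 0 by rewrite -mulmxA PX mulmx0.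
by rewrite !l !r oppr0.
Qed.

(** The terms with [Y] on the left have boundary [u - P u], because [X] commutes with the even part
    of a cycle and anticommutes with its odd part. The terms with [Y] on the right then replace
    [P u] by [P u P], since [P A Y X = P A (1 - P)] once [P A X = 0]. The signs reflect that [ad x]
    acts by a commutator on even parts and by an anticommutator on odd parts. *)
Definition potential u : q F n :=
  T (Y *m oddpart u - P *m oddpart u *m Y) (Y *m evenpart u + P *m evenpart u *m Y).

Lemma homotopy u : br (vsval x) u = 0 ->
  u = trunc F K u + br (vsval x) (potential u).
Proof.
move=> /adx_kerP[cA cB]; rewrite adxE /potential truncE evenpart_T oddpart_T.
rewrite T_add.
have PAX : P *m evenpart u *m X = 0 by rewrite -mulmxA -cA mulmxA PX mul0mx.
have PBX : P *m oddpart u *m X = 0.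
  by rewrite -mulmxA -[_ *m X]opprK -cB mulmxN mulmxA PX mul0mx oppr0.
(* The identity [1 = P + X Y + Y X] is used on the left of [Z], then on the right of [P Z], where
   the term in [P Z X] drops out. *)
have hP Z : P *m Z *m X = 0 ->
    Z = P *m Z *m P + (X *m Y *m Z + Y *m X *m Z + P *m Z *m Y *m X).
  move=> e; have -> : P *m Z *m Y *m X = P *m Z - P *m Z *m P.
    rewrite -mulmxA -[Y *m X](addKr (X *m Y)) XY mulmxDr mulmxN mulmxA e mul0mx.
    by rewrite oppr0 add0r mulmxBr mulmx1.
  by rewrite -mulmxDl XY mulmxBl mul1mx [RHS]addrC addrA !subrK.
apply: q_ext; rewrite ?evenpart_T ?oddpart_T.
  rewrite {1}(hP _ PAX) mulmxDr mulmxDl !mulmxA XP !mul0mx addr0 addrA.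
  by rewrite -(mulmxA Y _ X) -cA !mulmxA !addrA.
rewrite {1}(hP _ PBX) mulmxBr mulmxBl !mulmxA XP !mul0mx subr0 opprB addrA.
have BX : oddpart u *m X = - (X *m oddpart u) by rewrite cB opprK.
rewrite -[in RHS](mulmxA Y _ X) BX mulmxN opprK !mulmxA.
by rewrite [P *m oddpart u *m Y *m X + _]addrC !addrA.
Qed.

(** Between two components of cycles, [1 - P = X Y + Y X] contributes nothing: each summand has an
    [X] at one end, which moves outwards up to sign until it meets [P]. Hence
    [P Z P Z' P = P Z Z' P]. *)
Lemma trunc_br u v : br (vsval x) u = 0 -> br (vsval x) v = 0 ->
  trunc F K (br u v) = br (trunc F K u) (trunc F K v).
Proof.
move=> /adx_kerP[cA cB] /adx_kerP[cA' cB'].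
(* The scalars [e] and [e'] will be 1 for even parts and -1 for odd parts, so one identity serves
   all products. *)
have hP Z Z' (e e' : F) : Z *m X = e *: (X *m Z) -> X *m Z' = e' *: (Z' *m X) ->
    P *m Z *m P *m (P *m Z' *m P) = P *m (Z *m Z') *m P.
  move=> c c'; have -> : P *m Z *m P *m (P *m Z' *m P) =
      P *m Z *m (P *m P) *m Z' *m P by rewrite !mulmxA.
  have -> : P *m P = 1%:M - (X *m Y + Y *m X) by rewrite idK_idem XY subKr.
  rewrite mulmxBr mulmx1 !mulmxBl [X in _ - X](_ : _ = 0) ?subr0 ?mulmxA //.
  have l : P *m Z *m X = 0 by rewrite -mulmxA c -scalemxAr mulmxA PX mul0mx scaler0.
  have r : X *m (Z' *m P) = 0.
    by rewrite mulmxA c' -scalemxAl -mulmxA XP mulmx0 scaler0.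
  by rewrite mulmxDr !mulmxDl !mulmxA l !mul0mx add0r -!mulmxA r !mulmx0.
have s1 (M N : 'M[F]_n) : M = N -> M = 1 *: N by rewrite scale1r.
have s2 (M N : 'M[F]_n) : M = - N -> M = -1 *: N by rewrite scaleN1r.
have cBo : oddpart u *m X = - (X *m oddpart u) by rewrite cB opprK.
have cBo' : oddpart v *m X = - (X *m oddpart v) by rewrite cB' opprK.
have l1 := s1 _ _ (esym cA); have l2 := s2 _ _ cBo.
have l3 := s1 _ _ (esym cA'); have l4 := s2 _ _ cBo'.
have r1 := s1 _ _ cA; have r2 := s2 _ _ cB.
have r3 := s1 _ _ cA'; have r4 := s2 _ _ cB'.
rewrite !truncE T_br evenpart_br oddpart_br.
rewrite (hP _ _ _ _ l1 r3) (hP _ _ _ _ l3 r1) (hP _ _ _ _ l2 r4) (hP _ _ _ _ l4 r2).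
rewrite (hP _ _ _ _ l1 r4) (hP _ _ _ _ l4 r1) (hP _ _ _ _ l2 r3) (hP _ _ _ _ l3 r2).
by rewrite !(mulmxDr, mulmxDl, mulmxN, mulNmx).
Qed.

(** A cycle and its compression differ by a bracket, and brackets have odd trace zero. This makes
    compression send cycles of [sq_n] into [sq(K)]. *)
Lemma tr_odd_trunc u : br (vsval x) u = 0 ->
  \tr (oddpart (trunc F K u)) = \tr (oddpart u).
Proof.
by move/homotopy => {2}->; rewrite oddpartD mxtraceD tr_oddpart_br addr0.
Qed.

Lemma dsIm_adjP u : (u \in dsIm x (adj (q F n))) <->
  br (vsval x) u = 0 /\ trunc F K u = 0.
Proof.
split=> [/dsImP[w /= e ->] | [e z]]; first by rewrite trunc_adx.
apply/dsImP; exists (potential u) => /=.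
  by rewrite -e {2}(homotopy e) z add0r.
by rewrite {1}(homotopy e) z add0r.
Qed.

Lemma mem_invariants (A : derAlg (q F n)) (u : A) :
  (u \in invariants x A) = (u \in dsKer x A).
Proof.
have E : act_end x A u = da_act (vsval x) u by exact: act_endE.
by rewrite mem_dsKer_alg -E; exact: memv_ker.
Qed.

Lemma invariantsE (A : derAlg (q F n)) : invariants x A = dsKer x A.
Proof. by apply/vspaceP=> u; rewrite mem_invariants. Qed.

(** [dsIm] only admits primitives killed by the square of [x], which is automatic when the image is
    invariant. *)
Lemma image_invariantsE (A : derAlg (q F n)) :
  image_invariants x A = dsIm x A.
Proof.
apply/vspaceP=> u; rewrite memv_cap mem_invariants mem_dsKer_alg.
have D := @dsImP F (q F n) x (da_mod A) u.
have E (w : A) : act_end x A w = da_act (vsval x) w by exact: act_endE.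
apply/andP/idP => [[/memv_imgP[w _ eu] /eqP e] | /D[w e eu]].
  by apply/D; exists w; rewrite eu in e *; [rewrite E in e | exact: E].
split; last by apply/eqP; rewrite eu.
by apply/memv_imgP; exists w; rewrite ?memvf //; apply: etrans eu (esym (E w)).
Qed.

Lemma DS_complement_q : DS_complement x (adj (q F n)) (qK_sub F K).
Proof.
rewrite /DS_complement invariantsE image_invariantsE.
split; [exact: qK_subalgebra | exact: dsIm_ideal | |].
  apply/vspaceP=> u; rewrite mem_dsKer_alg; apply/memv_addP/eqP => /=.
    case=> v Kv [w /dsIm_adjP[e _] ->].
    apply: etrans (linfD (br_linr (vsval x : q F n)) v w) _.
    by rewrite [X in _ + X]e -(trunc_id Kv) adx_trunc addr0.
  move=> e; exists (trunc F K u); first exact: trunc_in.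
  exists (u - trunc F K u); last by rewrite addrC subrK.
  apply/dsIm_adjP; split.
    apply: etrans (linfB (br_linr (vsval x : q F n)) u (trunc F K u)) _.
    by rewrite [X in X - _]e adx_trunc subr0.
  by rewrite linearB /= (trunc_id (trunc_in K u)) subrr.
apply/eqP; rewrite -subv0; apply/subvP=> u /memv_capP[Ku /dsIm_adjP[_ e]].
by rewrite memv0 -(trunc_id Ku) e.
Qed.

(** * The subquotients when [J] is proper *)

Section ProperSubset.
Variable k0 : 'I_n.
Hypothesis Kk0 : k0 \in K.

(** Compressing [[x, u] = k T 1 0] gives [0 = k P], and [P] has a diagonal entry 1 at [k0]. *)
Lemma adx_center u : br (vsval x) u \in q_center F n -> br (vsval x) u = 0.
Proof.
move=> /q_centerP[k [e o]]; apply: q_ext; rewrite ?evenpart0 ?oddpart0 // e.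
have := congr1 (@evenpart F n) (trunc_adx u).
rewrite truncE evenpart_T evenpart0 e mul_mx_scalar -scalemxAl idK_idem.
move/matrixP/(_ k0 k0); rewrite idK_diag !mxE eqxx Kk0 mulr1n mulr1 => ->.
exact: raddf0.
Qed.

Lemma trunc1 : trunc F K (T 1%:M 0) = T P 0.
Proof.
by rewrite truncE evenpart_T oddpart_T mulmx1 idK_idem mulmx0 mul0mx.
Qed.

(** The unit [T 0 E_kk] at [k0] has odd trace 1 and lies in [q(K)], so [ad x] kills it; subtracting
    a multiple removes the odd trace without changing the boundary. *)
Lemma sq_adjust w :
  exists2 w', w' \in sq_sub F n & br (vsval x) w' = br (vsval x) w.
Proof.
exists (w - \tr (oddpart w) *: T 0 (delta_mx k0 k0)).
  rewrite mem_sq_sub oddpartB oddpartZ oddpart_T linearB linearZ /=.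
  by rewrite mxtrace_delta eqxx mulr1 subrr.
rewrite (linfB (br_linr _)) (linfZ (br_linr _)).
rewrite -[T 0 _](trunc_id (@qK_mem _ _ K k0 k0 true Kk0 Kk0)) adx_trunc.
by rewrite scaler0 subr0.
Qed.

Lemma trunc_center_of u w : u - br (vsval x) w \in q_center F n ->
  trunc F K u \in qK_center F K.
Proof.
move=> /vlineP[k ek]; apply/vlineP; exists k; rewrite -trunc1 -linearZ -ek.
by rewrite linearB /= trunc_adx subr0.
Qed.

(** Since [T 1 0 - T P 0 = [x, T 0 Y]], the centre of [q(K)] and that of [q_n] agree modulo
    boundaries. A cycle that compresses to [k T P 0] is therefore [k T 1 0] plus a boundary. *)
Lemma trunc_centerP u : br (vsval x) u = 0 -> trunc F K u \in qK_center F K ->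
  exists w, [/\ w \in sq_sub F n, br (vsval x) (br (vsval x) w) \in q_center F n
              & u - br (vsval x) w \in q_center F n].
Proof.
move=> e /vlineP[k ek].
pose w0 := potential u - k *: T 0 Y.
have xw0 : br (vsval x) w0 = u - k *: T 1%:M 0.
  have xY : br (vsval x) (T 0 Y) = T 1%:M 0 - T P 0.
    rewrite adxE evenpart_T oddpart_T XY mulmx0 mul0mx subrr T_opp T_add.
    by rewrite oppr0 addr0.
  have xp : br (vsval x) (potential u) = u - k *: T P 0.
    by rewrite [X in _ = X - _](homotopy e) ek addrAC subrr add0r.
  rewrite (linfB (br_linr _)) xp (linfZ (br_linr _)) xY scalerBr opprB.
  by rewrite addrA subrK.
have [w sw xw] := sq_adjust w0; rewrite xw0 in xw.
exists w; rewrite xw (linfB (br_linr _)) e adxZ1 subr0 mem0v subKr sw.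
by rewrite rpredZ // memv_line.
Qed.

Section CanonicalIso.
Variables (U S : {vspace q F n}).
Hypotheses (hU : ideal_in fullv U) (IU : (q_center F n <= U)%VS).
Hypotheses (hS : subalgebra S) (hSI : ideal_in S (qK_center F K)).
Hypotheses (SU : (S <= U)%VS) (SK : (S <= qK_sub F K)%VS).
Hypotheses (sqU : (sq_sub F n <= U)%VS).
Hypothesis truncS :
  forall u, u \in U -> br (vsval x) u = 0 -> trunc F K u \in S.

(** One argument for both central quotients: [U] is everything and [S] is [q(K)] for [pq], while [U]
    is [sq_n] and [S] is [sq(K)] for [psq]. *)
Lemma DS_canonical_iso_center :
  DS_canonical_iso x (quoAlg hU (q_center_ideal F n) IU) S (quoLie hS hSI)
    (qproj S (qK_center F K)) (qproj U (q_center F n)).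
Proof.
have [gS _] := hS; have [gI IS _] := hSI.
pose f : 'Hom(q F n, quoLie hS hSI) :=
  (qproj S (qK_center F K) \o trunc F K)%VF.
have fE u : f u = qproj S (qK_center F K) (trunc F K u) by rewrite comp_lfunE.
have fS u : u \in S -> f u = qproj S (qK_center F K) u.
  by move=> Su; rewrite fE trunc_id // (subvP SK).
have [] := @DS_quoAlg_iso F (q F n) U (q_center F n) hU (q_center_ideal F n) IU
  x (quoLie hS hSI) f.
- move=> u Uu /adx_center e; rewrite fE; split.
    move/eqP; rewrite qproj_eq0 // ?truncS // => /(trunc_centerP e)[w [sw h1 h2]].
    by exists w; rewrite (subvP sqU).
  case=> w [_ _ h]; apply/eqP; rewrite qproj_eq0 ?truncS //.
  exact: trunc_center_of h.
- move=> v; exists (vsval v).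
  have Sv : vsval v \in S by apply: qval_in.
  rewrite fS // qproj_val // (subvP SU) // -(trunc_id (subvP SK _ Sv)) adx_trunc.
  by rewrite mem0v.
- move=> a u Uu /adx_center e pu; rewrite fE [_ \in _]qproj_par ?truncS //.
  exact: trunc_par.
- move=> u v Uu /adx_center e Uv /adx_center e'.
  by rewrite !fE trunc_br // -quo_brE ?truncS.
(* Compression induces a map out of the homology, whereas the canonical map goes into it; hence the
   inverse. *)
move=> psi isopsi psiE; have [psi' isopsi' psiK] := lie_iso_inverse isopsi.
exists psi' => // u Su; have e : br (vsval x) u = 0.
  by rewrite -(trunc_id (subvP SK _ Su)) adx_trunc.
have Uu := subvP SU _ Su.
split; first by rewrite mem_invariants mem_dsKer_quoAlg // e mem0v.
by rewrite -fS // -psiE ?e ?mem0v // psiK.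
Qed.

End CanonicalIso.

Lemma DS_canonical_iso_pq :
  DS_canonical_iso x (pq F n) (qK_sub F K) (pqK F K)
    (qproj (qK_sub F K) (qK_center F K)) (qproj fullv (q_center F n)).
Proof.
apply: DS_canonical_iso_center; rewrite ?subvf ?subvv // => u _ _.
exact: trunc_in.
Qed.

Lemma DS_canonical_iso_psq :
  DS_canonical_iso x (psq F n) (sqK_sub F K) (psqK F K)
    (qproj (sqK_sub F K) (qK_center F K)) (qproj (sq_sub F n) (q_center F n)).
Proof.
apply: DS_canonical_iso_center; rewrite ?capvSl ?capvSr ?subvv // => u su e.
by rewrite memv_cap trunc_in mem_sq_sub tr_odd_trunc // -mem_sq_sub.
Qed.

(** The decomposition found for [q_n] restricts: compression preserves the odd trace of cycles, and
    primitives can be moved into [sq_n]. *)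
Lemma DS_complement_sq : DS_complement x (sq F n)
  (qproj (sq_sub F n) 0 @: sqK_sub F K)%VS.
Proof.
rewrite /DS_complement invariantsE image_invariantsE.
have [gS _ _] := sq_ideal F n; have g0 := @graded0 F (q F n).
have s0 := sub0v (sq_sub F n).
have inS u : u \in sqK_sub F K -> u \in sq_sub F n by case/memv_capP.
have kE u : u \in sq_sub F n ->
    (qproj (sq_sub F n) 0 u \in dsKer x (sq F n)) = (br (vsval x) u == 0).
  by move=> su; rewrite mem_dsKer_quoAlg // memv0.
have [gK bK] := sqK_subalgebra F K.
split; [ | exact: dsIm_ideal | | ].
- split.
    apply: gradedP => v /memv_imgP[u Ku ->].
    have [u0 [u1 [K0 p0 K1 p1 ->]]] := graded_split gK Ku.
    exists (qproj (sq_sub F n) 0 u0), (qproj (sq_sub F n) 0 u1).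
    by rewrite !memv_img // linearD ![_ \in par _]qproj_par ?inS.
  move=> u' v' /memv_imgP[u Ku ->] /memv_imgP[v Kv ->].
  have -> : br (qproj (sq_sub F n) 0 u : sq F n) (qproj (sq_sub F n) 0 v)
      = qproj (sq_sub F n) 0 (br u v).
    exact: (quo_brE (ideal_subalgebra (sq_ideal F n))
      (ideal_in0 (sq_sub F n)) (inS _ Ku) (inS _ Kv)).
  by rewrite memv_img ?bK.
- apply/vspaceP=> a; apply/idP/idP.
    case/memv_addP=> v /memv_imgP[u Ku ->] [w Iw ->]; rewrite rpredD //.
      by rewrite kE ?inS // -(trunc_id (subvP (capvSl _ _) _ Ku)) adx_trunc.
    exact: subvP (dsIm_sub x (sq F n)) _ Iw.
  rewrite -[a](qproj_val g0); have : vsval a \in sq_sub F n by apply: qval_in.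
  move: (vsval a) => u su; rewrite kE // => /eqP e.
  have Kt : trunc F K u \in sqK_sub F K.
    by rewrite memv_cap trunc_in mem_sq_sub tr_odd_trunc // -mem_sq_sub.
  apply/memv_addP; exists (qproj (sq_sub F n) 0 (trunc F K u)).
    exact: memv_img.
  exists (qproj (sq_sub F n) 0 (u - trunc F K u)); last first.
    by rewrite -linearD addrC subrK.
  apply/mem_dsIm_quoAlg; first by rewrite rpredB ?(inS _ Kt).
  (* The homotopy gives a primitive of [u - trunc F K u] in [q_n], and the adjustment moves it into
     [sq_n]. *)
  have [w sw xw] := sq_adjust (potential u); exists w.
  have -> : br (vsval x) w = u - trunc F K u.
    by rewrite xw {2}(homotopy e) addrC addKr.
  by rewrite subrr (linfB (br_linr _)) e adx_trunc subrr mem0v.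
apply/eqP; rewrite -subv0; apply/subvP=> a /memv_capP[/memv_imgP[u Ku ->]].
move=> /(mem_dsIm_quoAlg _ _ _ _ (inS _ Ku))[w [_ _ h]].
have /eqP e : u == br (vsval x) w by rewrite -subr_eq0 -memv0.
by rewrite -(trunc_id (subvP (capvSl _ _) _ Ku)) e trunc_adx linear0 mem0v.
Qed.

End ProperSubset.

(** * The embedding of the smaller queer superalgebra and the standard module *)

Section Embedding.
Variables (m : nat) (e : 'I_m -> 'I_n).
Hypotheses (e_inj : injective e) (e_codom : forall k, (k \in codom e) = (k \in K)).

(** Its columns are the basis vectors indexed by the values of [e]. Thus [E^T E = 1] and
    [E E^T = P], and the embedding of matrices is [A |-> E A E^T], with inverse [B |-> E^T B E] on
    compressed matrices. *)
Definition incl_mx : 'M[F]_(n, m) := \matrix_(i, j) (i == e j)%:R.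
Local Notation E := incl_mx.

Lemma incl_mxE (A : 'M[F]_m) : mx_incl e A = E *m A *m E^T.
Proof.
apply/matrixP=> i j; rewrite /mx_incl summxE mxE.
under [RHS]eq_bigr do rewrite mxE mulr_suml.
rewrite exchange_big /=; apply: eq_bigr => k _; rewrite summxE.
by apply: eq_bigr => l _; rewrite !mxE -mulnb natrM mulrCA mulrA.
Qed.

Lemma incl_mxK : E^T *m E = 1%:M.
Proof.
apply/matrixP=> i j; rewrite !mxE (bigD1 (e i)) //= big1 ?addr0.
  by rewrite !mxE eqxx mul1r (inj_eq e_inj).
by move=> k /negPf ki; rewrite !mxE ki mul0r.
Qed.

Lemma mul_incl_tr : E *m E^T = P.
Proof.
rewrite idK_diag; apply/matrixP=> i j; rewrite !mxE -e_codom.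
case: codomP => [[k ek] | nk].
  rewrite (bigD1 k) //= big1 ?addr0 => [|l lk]; last first.
    by rewrite !mxE ek (inj_eq e_inj) eq_sym (negPf lk) mul0r.
  by rewrite !mxE ek eqxx mul1r eq_sym.
rewrite big1 ?mul0rn // => k _; rewrite !mxE.
by case: eqP => [ek|]; rewrite ?mul0r //; case: nk; exists k.
Qed.

Lemma P_incl : P *m E = E.
Proof. by rewrite -mul_incl_tr -mulmxA incl_mxK mulmx1. Qed.

Lemma tr_incl_P : E^T *m P = E^T.
Proof. by rewrite -mul_incl_tr mulmxA incl_mxK mul1mx. Qed.

Lemma incl_mx_inj p (A B : 'M[F]_(m, p)) : E *m A = E *m B -> A = B.
Proof. by move/(congr1 (mulmx E^T)); rewrite !mulmxA incl_mxK !mul1mx. Qed.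

Lemma evenpart_q_incl (u : q F m) :
  evenpart (q_incl e u) = E *m evenpart u *m E^T.
Proof. by rewrite /q_incl evenpart_T incl_mxE. Qed.

Lemma oddpart_q_incl (u : q F m) :
  oddpart (q_incl e u) = E *m oddpart u *m E^T.
Proof. by rewrite /q_incl oddpart_T incl_mxE. Qed.

Lemma trunc_q_incl (u : q F m) : trunc F K (q_incl e u) = q_incl e u.
Proof.
have h (A : 'M[F]_m) : P *m (E *m A *m E^T) *m P = E *m A *m E^T.
  by rewrite -!mulmxA tr_incl_P !mulmxA P_incl.
rewrite truncE evenpart_q_incl oddpart_q_incl !h; apply: q_ext.
  by rewrite evenpart_T evenpart_q_incl.
by rewrite oddpart_T oddpart_q_incl.
Qed.

Lemma q_incl_in (u : q F m) : q_incl e u \in qK_sub F K.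
Proof. by rewrite -trunc_q_incl trunc_in. Qed.

Lemma q_incl_lin : linear (@q_incl F m n e).
Proof.
move=> k u v; apply: q_ext;
  rewrite ?(evenpartD, evenpartZ, oddpartD, oddpartZ, evenpart_q_incl, oddpart_q_incl);
  by rewrite mulmxDr mulmxDl -scalemxAr -scalemxAl.
Qed.

Lemma q_incl_br (u v : q F m) :
  q_incl e (br u v) = br (q_incl e u) (q_incl e v).
Proof.
have h (A B : 'M[F]_m) : E *m A *m E^T *m (E *m B *m E^T) = E *m (A *m B) *m E^T.
  by rewrite !mulmxA -(mulmxA _ E^T E) incl_mxK mulmx1.
apply: q_ext;
  rewrite ?(evenpart_q_incl, oddpart_q_incl, evenpart_br, oddpart_br) !h;
  by rewrite !(mulmxDr, mulmxDl, mulmxN, mulNmx).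
Qed.

Lemma q_incl_par b (u : q F m) : u \in par b -> q_incl e u \in par b.
Proof.
rewrite !mem_qpar_parts evenpart_q_incl oddpart_q_incl.
by case: b => /eqP ->; rewrite mulmx0 mul0mx.
Qed.

Lemma lie_iso_qK_incl : lie_iso (qK_incl F e K).
Proof.
have gS := (qK_subalgebra F K).1; have g0 := @graded0 F (q F n).
have lf : linear (fun u : q F m => qproj (qK_sub F K) 0 (q_incl e u)).
  by move=> k u v; rewrite q_incl_lin linearP.
have fE (u : q F m) : qK_incl F e K u = qproj (qK_sub F K) 0 (q_incl e u).
  by rewrite /qK_incl (linfun_funE lf).
split.
  split=> [b u pu | u v]; rewrite !fE.
    by rewrite [_ \in _]qproj_par ?q_incl_in ?sub0v ?q_incl_par.
  rewrite q_incl_br; apply/esym.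
  exact: (quo_brE (qK_subalgebra F K) (ideal_in0 _) (q_incl_in u) (q_incl_in v)).
apply: lfun_bijective => [u | w].
  rewrite fE => /eqP; rewrite qproj_eq0 ?sub0v ?q_incl_in // memv0 => /eqP z.
  have h (A : 'M[F]_m) : E *m A *m E^T = 0 -> A = 0.
    move/(congr1 (fun M => E^T *m M *m E)).
    by rewrite !mulmxA incl_mxK mul1mx -mulmxA incl_mxK mulmx1 mulmx0 mul0mx.
  apply: q_ext; rewrite ?evenpart0 ?oddpart0; apply: h.
    by rewrite -evenpart_q_incl z evenpart0.
  by rewrite -oddpart_q_incl z oddpart0.
have Kw : vsval w \in qK_sub F K by apply: qval_in.
exists (T (E^T *m evenpart (vsval w) *m E) (E^T *m oddpart (vsval w) *m E)).
rewrite fE -[RHS](qproj_val g0) -[in RHS](trunc_id Kw); congr (qproj _ _ _).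
rewrite truncE; apply: q_ext.
  by rewrite evenpart_q_incl !evenpart_T -mul_incl_tr !mulmxA.
by rewrite oddpart_q_incl !oddpart_T -mul_incl_tr !mulmxA.
Qed.

Lemma mem_std_ker (v : stdMod F n) : (v \in dsKer x (stdMod F n)) =
  (X *m usubmx v == 0) && (X *m dsubmx v == 0).
Proof.
rewrite mem_dsKer.
have -> : act (vsval x) v = col_mx (X *m dsubmx v) (X *m usubmx v).
  by rewrite /act /= /std_act xE val_T Tmx_mul !mul0mx add0r addr0.
by rewrite col_mx_eq0 andbC.
Qed.

(** If [X Z = 0], then [Z = P Z + X (Y Z)]: the class of a cycle is its projection by [P], and [Y]
    supplies primitives. *)
Lemma mem_std_im (v : stdMod F n) : v \in dsIm x (stdMod F n) <->
  v \in dsKer x (stdMod F n) /\ P *m usubmx v = 0 /\ P *m dsubmx v = 0.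
Proof.
have actx (w : stdMod F n) :
    act (vsval x) w = col_mx (X *m dsubmx w) (X *m usubmx w).
  by rewrite /act /= /std_act xE val_T Tmx_mul !mul0mx add0r addr0.
split=> [Iv | [/[!mem_std_ker]/andP[/eqP k1 /eqP k2] [p1 p2]]].
  split; first exact: subvP (dsIm_sub x (stdMod F n)) _ Iv.
  case/dsImP: Iv => w _ ->; rewrite actx col_mxKu col_mxKd.
  by rewrite !mulmxA PX !mul0mx.
have hX (Z : 'cV[F]_n) : X *m Z = 0 -> P *m Z = 0 -> X *m (Y *m Z) = Z.
  move=> e1 e2; have := congr1 (fun M => M *m Z) XY.
  by rewrite mulmxDl mulmxBl mul1mx -!mulmxA e1 e2 mulmx0 addr0 subr0.
have ev : v = col_mx (usubmx v) (dsubmx v) by rewrite vsubmxK.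
apply/dsImP; exists (col_mx (Y *m dsubmx v) (Y *m usubmx v)).
  by rewrite !actx !(col_mxKu, col_mxKd) !hX // k1 k2 col_mx0.
by rewrite actx col_mxKu col_mxKd !hX.
Qed.

Lemma std_act_ker (u : q F n) (v : stdMod F n) : br (vsval x) u = 0 ->
  v \in dsKer x (stdMod F n) -> act u v \in dsKer x (stdMod F n).
Proof.
move=> /adx_kerP[cA cB]; rewrite !mem_std_ker std_actE col_mxKu col_mxKd.
move=> /andP[/eqP k1 /eqP k2]; rewrite !mulmxDr !mulmxA cA cB -!mulmxA.
by rewrite !mulNmx -!mulmxA k1 k2 !mulmx0 oppr0 addr0 eqxx.
Qed.

(** For cycles, inserting [1 = P + X Y + Y X] gives [P A Z = (P A P) (P Z)]. The product is thus a
    boundary as soon as either factor is one, which gives both halves of the independence of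
    representatives. *)
Lemma std_act_trunc (u : q F n) (v : stdMod F n) : br (vsval x) u = 0 ->
  v \in dsKer x (stdMod F n) ->
  trunc F K u = 0 \/ P *m usubmx v = 0 /\ P *m dsubmx v = 0 ->
  act u v \in dsIm x (stdMod F n).
Proof.
move=> xu Kv h; apply/mem_std_im; split; first exact: std_act_ker.
move: xu Kv => /adx_kerP[cA cB]; rewrite mem_std_ker => /andP[/eqP k1 /eqP k2].
have hP A (Z : 'cV[F]_n) : P *m A *m X = 0 -> X *m Z = 0 ->
    P *m A *m P = 0 \/ P *m Z = 0 -> P *m (A *m Z) = 0.
  move=> e1 e2 h'; rewrite mulmxA -[Z]mul1mx -[1%:M](subrK P) -XY.
  rewrite !(mulmxDl, mulmxDr) -!mulmxA e2 !mulmx0 addr0 !mulmxA e1 !mul0mx add0r.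
  by case: h' => [-> | e3]; rewrite ?mul0mx // -!mulmxA e3 !mulmx0.
have PAX : P *m evenpart u *m X = 0 by rewrite -mulmxA -cA mulmxA PX mul0mx.
have PBX : P *m oddpart u *m X = 0.
  by rewrite -mulmxA -[_ *m X]opprK -cB mulmxN mulmxA PX mul0mx oppr0.
have [hA hB] : (forall Z : 'cV[F]_n, Z = usubmx v \/ Z = dsubmx v ->
    P *m evenpart u *m P = 0 \/ P *m Z = 0)
    /\ (forall Z : 'cV[F]_n, Z = usubmx v \/ Z = dsubmx v ->
    P *m oddpart u *m P = 0 \/ P *m Z = 0).
  case: h => [tu | [p1 p2]]; last by split=> Z [] ->; right.
  move: tu; rewrite truncE => tu; split=> Z _; left.
    by have := congr1 (@evenpart F n) tu; rewrite evenpart_T evenpart0.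
  by have := congr1 (@oddpart F n) tu; rewrite oddpart_T oddpart0.
rewrite std_actE col_mxKu col_mxKd !mulmxDr.
by rewrite !hP ?addr0 //; (apply: hA || apply: hB); auto.
Qed.

Lemma mem_dsKer_adj (u : q F n) :
  (u \in dsKer x (adj (q F n))) = (br (vsval x) u == 0).
Proof. exact: mem_dsKer. Qed.

Lemma DSmod_act (u : q F n) (v : stdMod F n) : br (vsval x) u = 0 ->
  v \in dsKer x (stdMod F n) ->
  act (DSlie_proj x (adj (q F n)) u) (DSproj x (stdMod F n) v : DSmod x _)
  = DSproj x (stdMod F n) (act u v).
Proof.
move=> xu Kv; set u' := vsval (DSlie_proj x (adj (q F n)) u).
set v' := vsval (DSproj x (stdMod F n) v).
have gK := dsKer_graded x (stdMod F n); have gI := dsIm_graded x (stdMod F n).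
have IK := dsIm_sub x (stdMod F n).
have Ku : u \in dsKer x (adj (q F n)) by rewrite mem_dsKer_adj xu.
have du : u - u' \in dsIm x (adj (q F n)).
  exact: (qproj_sub (dsKer_graded x (adj (q F n)))
      (dsIm_graded x (adj (q F n))) (dsIm_sub x (adj (q F n))) Ku).
have dv : v - v' \in dsIm x (stdMod F n) by apply: qproj_sub.
have xu' : br (vsval x) u' = 0.
  have : u' \in dsKer x (adj (q F n)) by apply: qval_in.
  by rewrite mem_dsKer_adj => /eqP.
have [ll lr _ _] := act_rep (stdMod F n).
apply/esym/qproj_eq => //; first exact: std_act_ker.
(* The induced action is computed on the chosen representatives [u'] and [v']; each summand here has
   one factor that is a boundary. *)
have -> : act u v - act u' v' = act (u - u') v + act u' (v - v').
  by rewrite (linfB (ll _)) (linfB (lr _)) addrA subrK.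
have /dsIm_adjP[e1 e2] := du; have /mem_std_im[k [p1 p2]] := dv.
rewrite rpredD // std_act_trunc //; first by left.
by right.
Qed.

Definition incl_std (v : stdMod F m) : stdMod F n :=
  col_mx (E *m usubmx v) (E *m dsubmx v).

Lemma DS_std_iso : exists phi : 'Hom(stdMod F m, DSmod x (stdMod F n)),
  [/\ bijective phi, forall b (v : stdMod F m), v \in par b -> phi v \in par b
    & forall (a : q F m) (v : stdMod F m), phi (act a v)
        = act (DSlie_proj x (adj (q F n)) (q_incl e a)) (phi v)].
Proof.
have gK := dsKer_graded x (stdMod F n); have gI := dsIm_graded x (stdMod F n).
have IK := dsIm_sub x (stdMod F n).
have XE : X *m E = 0 by rewrite -P_incl mulmxA XP mul0mx.
have inK (v : stdMod F m) : incl_std v \in dsKer x (stdMod F n).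
  by rewrite mem_std_ker col_mxKu col_mxKd !mulmxA XE !mul0mx eqxx.
have lf : linear (fun v : stdMod F m => DSproj x (stdMod F n) (incl_std v)).
  move=> k v w; rewrite -linearP; congr (DSproj _ _ _).
  rewrite /incl_std scale_col_mx add_col_mx !scalemxAr -!mulmxDr.
  by apply: (congr2 (fun M N : 'cV[F]_m => col_mx (E *m M) (E *m N)));
    apply/matrixP=> i j; rewrite !mxE.
exists (linfun (fun v : stdMod F m => DSproj x (stdMod F n) (incl_std v))); split.
- apply: lfun_bijective => [v | w].
    rewrite (linfun_funE lf) => /eqP; rewrite qproj_eq0 ?inK // => /mem_std_im.
    rewrite col_mxKu col_mxKd !mulmxA P_incl => -[_ [e1 e2]].
    by rewrite -[v]vsubmxK (@incl_mx_inj _ (usubmx v) 0) ?mulmx0 //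
      (@incl_mx_inj _ (dsubmx v) 0) ?mulmx0 // col_mx0.
  have Kw : vsval w \in dsKer x (stdMod F n) by apply: qval_in.
  set w0 := vsval w in Kw.
  exists (col_mx (E^T *m usubmx w0) (E^T *m dsubmx w0)).
  rewrite (linfun_funE lf) -[RHS](qproj_val gI).
  apply: qproj_eq; rewrite ?inK //; apply/mem_std_im; split.
    by rewrite rpredB ?inK.
  have uB (v v' : stdMod F n) : usubmx (v - v') = usubmx v - usubmx v'.
    by apply/matrixP=> i j; rewrite !mxE.
  have dB (v v' : stdMod F n) : dsubmx (v - v') = dsubmx v - dsubmx v'.
    by apply/matrixP=> i j; rewrite !mxE.
  rewrite uB dB /incl_std !(col_mxKu, col_mxKd) !mulmxA mul_incl_tr.
  by rewrite !mulmxBr !mulmxA idK_idem !subrr.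
- move=> b v pv; rewrite (linfun_funE lf) [_ \in _]qproj_par //.
  move: pv; rewrite ![_ \in par _]std_parE.
  by case: b => /eqP e0; rewrite ?(col_mxKu, col_mxKd) e0 mulmx0.
- move=> a v; rewrite !(linfun_funE lf) DSmod_act //; last first.
    by rewrite -trunc_q_incl adx_trunc.
  congr (DSproj _ _ _); rewrite !std_actE evenpart_q_incl oddpart_q_incl.
  rewrite /incl_std !(col_mxKu, col_mxKd) !mulmxA.
  by rewrite -!(mulmxA _ E^T E) incl_mxK !mulmx1 !mulmxDr !mulmxA.
Qed.
End Embedding.
End Homotopy.

(** * The case where [J] is the whole index set *)

Lemma sdim_q1 (F : numClosedFieldType) (b : bool) :
  \dim (par b : {vspace q F 1}) = 1%N.
Proof.
pose t : q F 1 := if b then T 0 1%:M else T 1%:M 0.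
have t0 : t != 0.
  apply/eqP => e; have : (if b then oddpart t else evenpart t) = 1%:M.
    by rewrite /t; case: (b); rewrite ?oddpart_T ?evenpart_T.
  rewrite e oddpart0 evenpart0 if_same => /matrixP/(_ 0 0)/eqP.
  by rewrite !mxE eq_sym oner_eq0.
have -> : par b = <[t]>%VS; last by rewrite dim_vline t0.
apply/vspaceP=> u; rewrite mem_qpar_parts; apply/eqP/vlineP => [e | [k ->]].
  exists ((if b then oddpart u else evenpart u) 0 0); rewrite /t.
  by case: b e {t t0} => e; apply: q_ext;
    rewrite ?evenpartZ ?oddpartZ ?evenpart_T ?oddpart_T ?e ?scaler0 //
      scalemx1 -mx11_scalar.
by rewrite /t; case: (b); rewrite ?evenpartZ ?oddpartZ ?evenpart_T ?oddpart_T scaler0.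
Qed.

Section FullSupport.
Variables (F : numClosedFieldType) (n : nat) (X Y : 'M[F]_n).
Variable x : odd_part (q F n).
Implicit Types (u v w : q F n) (A B Z : 'M[F]_n).
Hypotheses (n0 : (0 < n)%N) (xE : vsval x = T 0 X).
Hypothesis XY : X *m Y + Y *m X = 1%:M.

Let nF : n%:R != 0 :> F. Proof. by rewrite pnatr_eq0 -lt0n. Qed.

(** For a cycle [u] this is the odd trace of the primitive [T (Y B) (Y A)] from [adx_exact], that
    is, the obstruction to finding a primitive in [sq_n]. *)
Definition chi u : F := \tr (Y *m evenpart u).
(** Normalised to be the scalar in [[x, u] = k T 1 0]: taking traces in [X B + B X = k] gives
    [2 tr (X B) = n k]. *)
Definition lambda u : F := 2 / n%:R * \tr (X *m oddpart u).

Lemma chi_lin : linear (chi : q F n -> F^o).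
Proof.
move=> k u v; rewrite /chi evenpartD evenpartZ mulmxDr -scalemxAr.
by rewrite mxtraceD mxtraceZ.
Qed.

Lemma lambda_lin : linear (lambda : q F n -> F^o).
Proof.
move=> k u v; rewrite /lambda oddpartD oddpartZ mulmxDr -scalemxAr.
by rewrite mxtraceD mxtraceZ mulrDr mulrCA.
Qed.

Lemma tr_YX : \tr (Y *m X) = n%:R / 2.
Proof.
have : \tr (X *m Y + Y *m X) = n%:R by rewrite XY mxtrace1.
rewrite mxtraceD mxtrace_mulC => <-.
by rewrite -mulr2n -[\tr _ *+ 2]mulr_natr mulfK // pnatr_eq0.
Qed.

(** Insert [1 = X Y + Y X] between [Z] and [B]. Carrying [X] around the trace, past [B] with a sign
    and past [Z] without one, turns one summand into minus the other. *)
Lemma tr_mul_anticomm Z B :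
  X *m Z = Z *m X -> X *m B = - (B *m X) -> \tr (Z *m B) = 0.
Proof.
move=> cZ cB; rewrite -[B]mul1mx -XY mulmxDl mulmxDr mxtraceD.
rewrite -(mulmxA Y X B) cB mulmxN !mulmxA -cZ mulmxN linearN /=.
by rewrite !mulmxA [X in _ - X]mxtrace_mulC !mulmxA subrr.
Qed.

Lemma lambda_spec u : br (vsval x) u \in q_center F n ->
  X *m evenpart u = evenpart u *m X
  /\ X *m oddpart u + oddpart u *m X = (lambda u)%:M.
Proof.
rewrite (adxE xE) => /q_centerP[k []]; rewrite evenpart_T oddpart_T => e.
move/eqP; rewrite subr_eq0 => /eqP o; split=> //; rewrite e; congr (_%:M).
have h : \tr (X *m oddpart u) * 2 = k * n%:R.
  rewrite mulr_natr mulr2n mulr_natr -mxtrace_scalar -e mxtraceD.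
  by rewrite [X in _ = _ + X]mxtrace_mulC.
by rewrite /lambda mulrAC [2 * _]mulrC h mulfK.
Qed.

Lemma lambda_adx u : br (vsval x) u \in q_center F n ->
  br (vsval x) u = lambda u *: T 1%:M 0.
Proof.
move=> /lambda_spec[e o]; rewrite (adxE xE) o e subrr -T_scale scaler0.
by rewrite scalemx1.
Qed.

Lemma chi_adx w : chi (br (vsval x) w) = \tr (oddpart w).
Proof.
rewrite /chi (adxE xE) evenpart_T mulmxDr mxtraceD !mulmxA.
by rewrite [X in _ + X]mxtrace_mulC mulmxA -mxtraceD -mulmxDl addrC XY mul1mx.
Qed.

Lemma lambda_adx0 w : lambda (br (vsval x) w) = 0.
Proof.
rewrite /lambda (adxE xE) oddpart_T mulmxBr linearB /= [X in _ - X]mxtrace_mulC.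
by rewrite -mulmxA [X in _ - X]mxtrace_mulC -!mulmxA subrr mulr0.
Qed.

Lemma chi_center k : chi (k *: T 1%:M 0) = k * \tr Y.
Proof. by rewrite /chi evenpartZ evenpart_T -scalemxAr mulmx1 mxtraceZ. Qed.

Lemma lambda_center k : lambda (k *: T 1%:M 0) = 0.
Proof.
by rewrite /lambda oddpartZ oddpart_T scaler0 mulmx0 mxtrace0 mulr0.
Qed.

(** The homotopy for the empty set of indices, where the compression is zero. *)
Lemma adx_exact u : br (vsval x) u = 0 ->
  u = br (vsval x) (T (Y *m oddpart u) (Y *m evenpart u)).
Proof.
have z : idK F (set0 : {set 'I_n}) = 0 by exact: idK0.
have XY' : X *m Y + Y *m X = 1%:M - idK F (set0 : {set 'I_n}) by rewrite z subr0.
have PX : idK F (set0 : {set 'I_n}) *m X = 0 by rewrite z mul0mx.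
have XP : X *m idK F (set0 : {set 'I_n}) = 0 by rewrite z mulmx0.
move/(homotopy xE PX XP XY'); rewrite truncE /potential z.
by rewrite !mul0mx T0 add0r subr0 addr0.
Qed.

(** Subtracting [lambda u Y] from the odd part of [u] leaves a matrix [B1] that anticommutes with
    [X], and likewise [B2] for [v]. Every term of the expansion except the one in [Y^3] is then the
    trace of a matrix commuting with [X] times one anticommuting with it, and [tr_mul_anticomm]
    kills it. *)
Lemma chi_br u v :
  br (vsval x) u \in q_center F n -> br (vsval x) v \in q_center F n ->
  chi (br u v) = 2 * lambda u * lambda v * \tr (Y *m Y *m Y).
Proof.
move=> /lambda_spec[cA oB] /lambda_spec[cA' oB'].
pose B1 := oddpart u - lambda u *: Y; pose B2 := oddpart v - lambda v *: Y.
have anti B l : X *m B + B *m X = l%:M ->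
    X *m (B - l *: Y) = - ((B - l *: Y) *m X).
  move=> h; apply/eqP; rewrite -subr_eq0 opprK mulmxBr mulmxBl addrACA h.
  by rewrite -scalemxAr -scalemxAl -opprD -scalerDr XY scalemx1 subrr.
have a1 := anti _ _ oB; have a2 := anti _ _ oB'; rewrite -/B1 -/B2 in a1 a2.
have eB : oddpart u = B1 + lambda u *: Y by rewrite subrK.
have eB' : oddpart v = B2 + lambda v *: Y by rewrite subrK.
(* [Y] has anticommutator 1 with [X], so its square commutes with [X]. *)
have XYY : X *m (Y *m Y) = (Y *m Y) *m X.
  have h1 : X *m Y = 1%:M - Y *m X by rewrite -XY addrK.
  rewrite mulmxA h1 mulmxBl mul1mx -(mulmxA Y X Y) h1 mulmxBr mulmx1 opprB.
  by rewrite addrC subrK mulmxA.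
(* Cyclicity isolates the even part of [v], which commutes with [X]; the commutator of [Y] with the
   even part of [u] anticommutes with [X]. *)
have tA : \tr (Y *m (evenpart u *m evenpart v - evenpart v *m evenpart u)) = 0.
  have -> : \tr (Y *m (evenpart u *m evenpart v - evenpart v *m evenpart u))
      = \tr (evenpart v *m (Y *m evenpart u - evenpart u *m Y)).
    rewrite !mulmxBr !linearB /= !mulmxA; congr (_ - _).
      by rewrite [LHS]mxtrace_mulC mulmxA.
    by rewrite [RHS]mxtrace_mulC mulmxA.
  apply: tr_mul_anticomm => //; apply/eqP; rewrite -subr_eq0 opprK.
  rewrite mulmxBr mulmxBl addrACA !mulmxA -(mulmxA Y _ X) -cA !mulmxA.
  rewrite -mulmxDl XY mul1mx cA -!(mulmxA (evenpart u)) -opprD -mulmxDr XY.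
  by rewrite mulmx1 subrr.
have tYB B : X *m B = - (B *m X) -> \tr (Y *m Y *m B) = 0.
  exact: tr_mul_anticomm.
(* Here the commuting factor is the anticommutator of [Y] and [B1]. *)
have tBB : \tr (Y *m (B1 *m B2 + B2 *m B1)) = 0.
  have -> : \tr (Y *m (B1 *m B2 + B2 *m B1))
      = \tr ((Y *m B1 + B1 *m Y) *m B2).
    rewrite mulmxDr mulmxDl !mxtraceD !mulmxA; congr (_ + _).
    by rewrite [LHS]mxtrace_mulC mulmxA.
  apply: tr_mul_anticomm => //; apply/eqP; rewrite -subr_eq0 mulmxDr mulmxDl.
  have e1 : X *m (B1 *m Y) = - (B1 *m X *m Y) by rewrite mulmxA a1 mulNmx.
  have e2 : Y *m B1 *m X = - (Y *m X *m B1).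
    by rewrite -!mulmxA a1 mulmxN opprK.
  rewrite e1 e2 opprD opprK addrACA !mulmxA -mulmxDl XY mul1mx -opprD.
  rewrite -!(mulmxA B1) -mulmxDr XY.
  by rewrite mulmx1 subrr.
have tYBY B : X *m B = - (B *m X) -> \tr (Y *m (Y *m B + B *m Y)) = 0.
  move=> aB; rewrite mulmxDr mxtraceD mulmxA tYB // add0r.
  by rewrite mxtrace_mulC -mulmxA mxtrace_mulC tYB.
rewrite /chi evenpart_br mulmxDr mxtraceD tA add0r eB eB'.
set a := lambda u; set b := lambda v.
have -> : (B1 + a *: Y) *m (B2 + b *: Y) + (B2 + b *: Y) *m (B1 + a *: Y)
    = (B1 *m B2 + B2 *m B1) + b *: (Y *m B1 + B1 *m Y)
      + a *: (Y *m B2 + B2 *m Y) + (2 * a * b) *: (Y *m Y).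
  rewrite !(mulmxDl, mulmxDr) -?scalemxAl -?scalemxAr -?scalemxAl !scalerDr.
  rewrite -?scalemxAr !scalerA [b * a]mulrC -mulrA [2 * _]mulr_natl mulr2n scalerDl.
  set c1 := B1 *m B2; set c2 := B2 *m B1; set c3 := a * b *: _.
  set d1 := b *: (B1 *m Y); set d2 := b *: (Y *m B1).
  set d3 := a *: (B2 *m Y); set d4 := a *: (Y *m B2).
  apply/matrixP=> i j; rewrite !mxE; ring.
rewrite !(mulmxDr Y) !mxtraceD -!scalemxAr !mxtraceZ -!mxtraceD -!mulmxDr tBB.
by rewrite !tYBY // !mulr0 !add0r mulmxA.
Qed.

Lemma lambda_br u v :
  br (vsval x) u \in q_center F n -> br (vsval x) v \in q_center F n ->
  lambda (br u v) = 0.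
Proof.
move=> /lambda_spec[cA _] /lambda_spec[cA' _].
have h A B : X *m A = A *m X -> \tr (X *m (A *m B - B *m A)) = 0.
  move=> c; rewrite mulmxBr linearB /= mulmxA c -mulmxA mxtrace_mulC.
  by rewrite mulmxA subrr.
rewrite /lambda oddpart_br mulmxDr mxtraceD h // -opprB mulmxN linearN /= h //.
by rewrite subr0 mulr0.
Qed.

Definition chi_hom : 'Hom(q F n, line F) := linfun (chi : q F n -> F^o).
Definition lambda_hom : 'Hom(q F n, line F) := linfun (lambda : q F n -> F^o).

Lemma lambda_eq0 u : br (vsval x) u = 0 -> lambda u = 0.
Proof.
move=> e; have : br (vsval x) u \in q_center F n by rewrite e mem0v.
move/lambda_adx; rewrite e => /(congr1 (fun w => \tr (evenpart w))).
rewrite evenpart0 mxtrace0 evenpartZ evenpart_T mxtraceZ mxtrace1 => /eqP.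
by rewrite eq_sym mulf_eq0 (negPf nF) orbF => /eqP.
Qed.

Lemma adx_potential_sq u : br (vsval x) u = 0 -> chi u = 0 ->
  exists2 w, w \in sq_sub F n & br (vsval x) w = u.
Proof.
move=> e c; exists (T (Y *m oddpart u) (Y *m evenpart u)).
  by rewrite mem_sq_sub oddpart_T -/(chi u) c.
by rewrite -adx_exact.
Qed.

Lemma chi_TX k : chi (k *: T X 0) = k * (n%:R / 2).
Proof. by rewrite /chi evenpartZ evenpart_T -scalemxAr mxtraceZ tr_YX. Qed.

Lemma adx_TX k : br (vsval x) (k *: T X 0) = 0.
Proof.
rewrite (linfZ (br_linr _)) (adxE xE) evenpart_T oddpart_T subrr.
by rewrite mulmx0 mul0mx addr0 T0 scaler0.
Qed.

Lemma lambda_TX k : lambda (k *: T X 0) = 0.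
Proof. exact/lambda_eq0/adx_TX. Qed.

Lemma adx_TY k : br (vsval x) (k *: T 0 Y) = k *: T 1%:M 0.
Proof.
rewrite (linfZ (br_linr _)) (adxE xE) evenpart_T oddpart_T XY.
by rewrite mulmx0 mul0mx subrr.
Qed.

Lemma lambda_TY k : lambda (k *: T 0 Y) = k.
Proof.
rewrite /lambda oddpartZ oddpart_T -scalemxAr mxtraceZ mxtrace_mulC tr_YX.
by field; exact: nF.
Qed.

Lemma chi_TY k : chi (k *: T 0 Y) = 0.
Proof. by rewrite /chi evenpartZ evenpart_T scaler0 mulmx0 mxtrace0. Qed.

Let half_n : n%:R / 2 != 0 :> F.
Proof. by rewrite mulf_neq0 // invr_neq0 // pnatr_eq0. Qed.

(** [chi] sees only even parts, so the line is even; it is hit by multiples of [T X 0], where [chi]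
    takes the value [n / 2]. *)
Lemma DS_sq_full : lie_isomorphic (DSlie x (sq F n)) (abelianLie (line F)).
Proof.
have fE u : chi_hom u = chi u by exact: (linfun_funE chi_lin).
have [] := @DS_quoAlg_iso F (q F n) (sq_sub F n) 0 (sq_ideal F n)
  (ideal_in0 fullv) (sub0v _) x (abelianLie (line F)) chi_hom.
- move=> u su /[1!memv0]/eqP e; rewrite [chi_hom u]fE.
  split=> [/(adx_potential_sq e)[w sw xw] | [w [sw _]]].
    by exists w; rewrite xw e subrr mem0v.
  by rewrite memv0 subr_eq0 => /eqP ->; rewrite chi_adx; apply/eqP; rewrite -mem_sq_sub.
- move=> v; exists ((v / (n%:R / 2) : F) *: T X 0).
  rewrite mem_sq_sub oddpartZ oddpart_T scaler0 mxtrace0 adx_TX mem0v eqxx.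
  by split=> //; rewrite [LHS]fE chi_TX divfK.
- move=> a u _ _; rewrite mem_qpar_parts => pu; rewrite [chi_hom u]fE.
  case: a pu => [/eqP e|_]; last exact: memvf.
  by rewrite /chi e mulmx0 mxtrace0 mem0v.
- move=> u v _ /[1!memv0]/eqP e _ /[1!memv0]/eqP e'; rewrite [LHS]fE.
  by rewrite chi_br ?e ?e' ?mem0v // lambda_eq0 // mulr0 !mul0r.
by move=> psi isopsi _; exists psi.
Qed.

(** [lambda] sees only odd parts, whence the parity change; the class is that of [T 0 Y], whose
    boundary is central. *)
Lemma DS_pq_full :
  lie_isomorphic (DSlie x (pq F n)) (abelianLie (parity_change (line F))).
Proof.
have fE u : lambda_hom u = lambda u by exact: (linfun_funE lambda_lin).
have [] := @DS_quoAlg_iso F (q F n) fullv (q_center F n) (ideal_inT (q F n))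
  (q_center_ideal F n) (subvf _) x (abelianLie (parity_change (line F))) lambda_hom.
- move=> u _ cu; rewrite [lambda_hom u]fE; split=> [z | [w [_ _ /vlineP[k]]]].
    have e : br (vsval x) u = 0 by rewrite lambda_adx // z scale0r.
    exists (T (Y *m oddpart u) (Y *m evenpart u)).
    by rewrite -adx_exact // e subrr memvf !mem0v.
  move/eqP; rewrite subr_eq => /eqP ->.
  by rewrite (linfD lambda_lin) lambda_adx0 lambda_center addr0.
- move=> v; exists ((v : F) *: T 0 Y); rewrite memvf adx_TY.
  by rewrite rpredZ ?memv_line //; split=> //; rewrite [LHS]fE lambda_TY.
- move=> a u _ _; rewrite mem_qpar_parts => pu; rewrite [lambda_hom u]fE.
  case: a pu => [_|/eqP e]; first exact: memvf.
  by rewrite /lambda e mulmx0 mxtrace0 mulr0 mem0v.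
- move=> u v _ cu _ cv; rewrite [LHS]fE.
  exact: lambda_br.
by move=> psi isopsi _; exists psi.
Qed.

(** Applying [chi] to [[x, v] = lambda v T 1 0] shows that [lambda v tr Y] is the odd trace of [v],
    hence zero: the odd class disappears. The even class disappears too, because a central multiple
    has any prescribed value of [chi]. *)
Lemma DS_psq_full0 : \tr Y != 0 -> forall u : DSlie x (psq F n), u = 0.
Proof.
move=> tY u.
(* [q F 0] serves as the zero Lie superalgebra. *)
have q0 (v w : q F 0) : v = w by apply: q_ext; apply/matrixP=> -[].
have [] := @DS_quoAlg_iso F (q F n) (sq_sub F n) (q_center F n) (sq_ideal F n)
  (q_center_ideal F n) (q_center_sub_sq F n) x (q F 0) 0.
- move=> v sv cv; split=> // _.
  have lv : lambda v = 0.
    have := chi_adx v; rewrite lambda_adx // chi_center.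
    move: sv; rewrite mem_sq_sub => /eqP -> /eqP; rewrite mulf_eq0 (negPf tY) orbF.
    by move/eqP.
  pose k := chi v / \tr Y; pose v' := v - k *: T 1%:M 0.
  have xv : br (vsval x) v = 0 by rewrite lambda_adx // lv scale0r.
  have xv' : br (vsval x) v' = 0.
    by rewrite (linfB (br_linr _)) xv sub0r (linfZ (br_linr _)) br1 scaler0 oppr0.
  have cv' : chi v' = 0.
    by rewrite /v' (linfB chi_lin) chi_center divfK // subrr.
  have [w sw xw] := adx_potential_sq xv' cv'; exists w.
  by rewrite xw xv' mem0v sw subKr rpredZ ?memv_line.
- by move=> v; exists 0; rewrite (linf0 (br_linr _)) !mem0v; split=> //; apply: q0.
- by move=> a v _ _ _; rewrite lfunE mem0v.
- by move=> v w *; apply: q0.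
move=> psi [_ psibij] _; apply: (bij_inj psibij); exact: q0.
Qed.

(** * The case of full support with vanishing trace of [Y] *)

Section TraceZero.
Hypothesis tY : \tr Y = 0.

(* [alpha] normalises the image of [T X 0], the square of the odd class [T 0 Y]. *)
Variable alpha : F.
Hypothesis alpha0 : alpha != 0.

Definition to_q1 u : q F 1 := T (alpha * chi u)%:M (lambda u)%:M.

Lemma to_q1_lin : linear to_q1.
Proof.
move=> k u v; rewrite /to_q1 chi_lin lambda_lin -T_scale T_add; congr T.
  by rewrite mulrDr raddfD /= scale_scalar_mx -[k *: _]/(k * chi u) mulrCA.
by rewrite raddfD /= scale_scalar_mx.
Qed.

(** The map [j] allows the superspace of [q_1] to carry another bracket, so that the commutative
    case and the case of [q_1] share this proof. The vanishing of [tr Y] puts [T 0 Y] into [sq_n]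
    and makes [chi] vanish on the centre. *)
Lemma DS_psq_traceless (h : lieSuper F) (j : 'Hom(q F 1, h)) :
  bijective j ->
  (forall b (v : q F 1), v \in par b -> j v \in (par b : {vspace h})) ->
  (forall a b a' b', br (j (T a%:M b%:M)) (j (T a'%:M b'%:M))
     = j (T (alpha * (2 * b * b' * \tr (Y *m Y *m Y)))%:M 0)) ->
  exists psi : 'Hom(DSlie x (psq F n), h), lie_iso psi.
Proof.
move=> jbij jpar jbr; pose f : 'Hom(q F n, h) := (j \o linfun to_q1)%VF.
have fE u : f u = j (to_q1 u) by rewrite comp_lfunE (linfun_funE to_q1_lin).
have [] := @DS_quoAlg_iso F (q F n) (sq_sub F n) (q_center F n) (sq_ideal F n)
  (q_center_ideal F n) (q_center_sub_sq F n) x h f.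
- move=> u su cu; rewrite fE -[X in _ = X <-> _](linear0 j).
  have -> : (j (to_q1 u) = j 0) <-> (chi u = 0 /\ lambda u = 0).
    split=> [/(bij_inj jbij) z | [z1 z2]]; last first.
      by rewrite /to_q1 z1 z2 mulr0 raddf0 T0.
    have := congr1 (@evenpart F 1) z; have := congr1 (@oddpart F 1) z.
    rewrite evenpart_T oddpart_T evenpart0 oddpart0.
    move=> /matrixP/(_ 0 0) + /matrixP/(_ 0 0); rewrite !mxE !mulr1n => -> /eqP.
    by rewrite mulf_eq0 (negPf alpha0) => /eqP.
  split=> [[z1 z2] | [w [sw _ /vlineP[k]]]].
    have e : br (vsval x) u = 0 by rewrite lambda_adx // z2 scale0r.
    have [w sw xw] := adx_potential_sq e z1.
    by exists w; rewrite xw e subrr !mem0v.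
  move/eqP; rewrite subr_eq => /eqP ->.
  rewrite (linfD lambda_lin) (linfD chi_lin) lambda_adx0 lambda_center.
  rewrite chi_adx chi_center tY mulr0 addr0 add0r; split=> //.
  by apply/eqP; rewrite -mem_sq_sub.
- move=> v; have [j' _ jK] := jbij.
  pose a := evenpart (j' v) 0 0; pose b := oddpart (j' v) 0 0.
  (* [T X 0] has coordinates [chi = n / 2], [lambda = 0], and [T 0 Y] has [chi = 0], [lambda = 1];
     the coefficients solve [alpha * chi = a] and [lambda = b]. *)
  exists ((a / alpha / (n%:R / 2)) *: T X 0 + b *: T 0 Y).
  rewrite (linfD (br_linr _)) adx_TX adx_TY add0r rpredZ ?memv_line //.
  rewrite mem_sq_sub oddpartD !oddpartZ !oddpart_T scaler0 add0r mxtraceZ tY.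
  rewrite mulr0 eqxx; split=> //; rewrite fE -[RHS]jK; congr (j _).
  rewrite /to_q1 (linfD chi_lin) (linfD lambda_lin) chi_TX chi_TY lambda_TX.
  rewrite lambda_TY addr0 add0r divfK // mulrC divfK //.
  by rewrite [RHS]T_surj; congr T; rewrite -mx11_scalar.
- move=> a u _ _ pu; rewrite fE jpar //; move: pu.
  rewrite !mem_qpar_parts /to_q1 evenpart_T oddpart_T /chi /lambda.
  by case: a => /eqP ->; rewrite mulmx0 mxtrace0 mulr0 raddf0.
- move=> u v _ cu _ cv; rewrite !fE jbr; congr (j _).
  by rewrite /to_q1 chi_br // lambda_br // raddf0.
by move=> psi isopsi _; exists psi.
Qed.

End TraceZero.

Lemma DS_psq_q1 : \tr Y = 0 -> \tr (Y *m Y *m Y) != 0 ->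
  lie_isomorphic (DSlie x (psq F n)) (q F 1).
Proof.
(* In [q_1] the bracket of [T 0 b] and [T 0 b'] is [T (2 b b') 0], so [alpha] has to cancel the
   factor [tr (Y^3)] in [chi_br]. *)
move=> tY tY3; have a0 : (\tr (Y *m Y *m Y))^-1 != 0 by rewrite invr_eq0.
have [] := @DS_psq_traceless tY _ a0 (q F 1) \1%VF.
- by exists id => u; rewrite id_lfunE.
- by move=> b v; rewrite id_lfunE.
- move=> a b a' b'; rewrite !id_lfunE T_br -!scalar_mxM.
  rewrite [a' * a]mulrC [b' * b]mulrC [a' * b]mulrC [b' * a]mulrC !subrr addr0.
  by rewrite add0r -raddfD /= [_^-1 * _]mulrC mulfK // -mulrA mulr_natl mulr2n.
by move=> psi isopsi; exists psi.
Qed.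

Lemma DS_psq_commutative : \tr Y = 0 -> \tr (Y *m Y *m Y) = 0 ->
  has_sdim (DSlie x (psq F n)) 1 1 /\ commutative_lie (DSlie x (psq F n)).
Proof.
move=> tY tY3.
(* [abelianLie (q F 1)] has the underlying superspace of [q_1], so [j] is the identity; the bracket
   vanishes with [tr (Y^3)], and [alpha = 1] will do. *)
have [] := @DS_psq_traceless tY 1 (oner_neq0 F) (abelianLie (q F 1)) \1%VF.
- by exists id => u; rewrite id_lfunE.
- by move=> b v; rewrite id_lfunE.
- by move=> a b a' b'; rewrite tY3 !mulr0 raddf0 T0 linear0.
move=> psi isopsi; split.
  by split; rewrite (lie_iso_sdim isopsi) sdim_q1.
move=> u v; have [[_ psibr] psibij] := isopsi; apply: (bij_inj psibij).
by rewrite psibr linear0.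
Qed.

End FullSupport.

(** * Diagonalisation from eigenvectors and sums of matrix units *)

Lemma lsemisimple_span (F : numClosedFieldType) (V : vectType F)
    (f : 'End(V)) (X : seq V) :
  <<X>>%VS = fullv -> (forall v, v \in X -> exists a : F, f v = a *: v) ->
  lsemisimple f.
Proof.
move=> spanX eigX.
have [Z [ZX fZ sZ]] : exists Z, [/\ {subset Z <= X}, free Z & <<Z>>%VS = <<X>>%VS].
  elim: X {spanX eigX} => [|v X [Z [ZX fZ sZ]]].
    by exists [::]; split=> //; apply: nil_free.
  have sub : {subset Z <= v :: X} by move=> u /ZX Xu; rewrite inE Xu orbT.
  case: (boolP (v \in <<Z>>%VS)) => Zv.
    exists Z; split=> //; rewrite span_cons -sZ; apply/esym/addv_idPr.
    by rewrite -memvE.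
  exists (v :: Z); rewrite free_cons Zv fZ !span_cons sZ; split=> // u.
  by rewrite !inE => /orP[-> // | /ZX ->]; rewrite orbT.
by exists Z => [|v /ZX /eigX //]; rewrite basisEfree fZ sZ spanX subvv dimvf /=
  -dimvf -spanX -sZ (eqP fZ).
Qed.

Section DeltaSums.
Variables (F : fieldType) (n : nat).
Implicit Types (a b : nat -> F) (f g h : nat -> 'I_n).

Lemma mul_sum_delta a b f g h k m m' :
  (forall p q, (m <= p < m')%N -> (m <= q < m')%N -> g p = h q -> p = q) ->
  (forall p, (m <= p < m')%N -> g p = h p) ->
  (\sum_(m <= p < m') a p *: delta_mx (f p) (g p))
    *m (\sum_(m <= q < m') b q *: delta_mx (h q) (k q))
  = \sum_(m <= p < m') (a p * b p) *: delta_mx (f p) (k p) :> 'M[F]_n.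
Proof.
move=> gh_inj gh; rewrite mulmx_suml !big_nat; apply: eq_bigr => p hp.
rewrite mulmx_sumr -big_nat (bigD1_seq p) ?mem_index_iota ?iota_uniq //=.
rewrite [X in _ + X]big_nat_cond big1 => [|q /andP[hq qp]].
  by rewrite addr0 -scalemxAl -scalemxAr scalerA (gh p hp) mul_delta_mx.
rewrite -scalemxAl -scalemxAr mul_delta_mx_cond; case: eqP => [e|_].
  by rewrite (gh_inj _ _ hp hq e) eqxx in qp.
by rewrite mulr0n !scaler0.
Qed.

Lemma mul_sum_delta0 a b f g h k m m' l l' :
  (forall p q, (m <= p < m')%N -> (l <= q < l')%N -> g p <> h q) ->
  (\sum_(m <= p < m') a p *: delta_mx (f p) (g p))
    *m (\sum_(l <= q < l') b q *: delta_mx (h q) (k q)) = 0 :> 'M[F]_n.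
Proof.
move=> gh; rewrite mulmx_suml big_nat big1 // => p hp.
rewrite mulmx_sumr big_nat big1 // => q hq.
rewrite -scalemxAl -scalemxAr mul_delta_mx_cond.
by case: eqP => [/gh|_]; [move=> H; case: (H hp hq) | rewrite mulr0n !scaler0].
Qed.

(** The matrix factors through dimension [m' - m], which bounds the rank above; [M A N = 1] bounds
    it below. *)
Lemma rank_sum_delta a f g m m' :
  (forall p, (m <= p < m')%N -> a p != 0) ->
  (forall p q, (m <= p < m')%N -> (m <= q < m')%N -> f p = f q -> p = q) ->
  (forall p q, (m <= p < m')%N -> (m <= q < m')%N -> g p = g q -> p = q) ->
  \rank (\sum_(m <= p < m') a p *: delta_mx (f p) (g p) : 'M[F]_n)%R = (m' - m)%N.
Proof.
move=> a0 f_inj g_inj; set A := (X in \rank X).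
have lt (i : 'I_(m' - m)) : (m <= m + i < m')%N.
  by rewrite leq_addr -ltn_subRL /=.
pose M : 'M[F]_(m' - m, n) := \matrix_(i, j) ((a (m + i))^-1 *+ (f (m + i) == j)).
pose N : 'M[F]_(n, m' - m) := \matrix_(j, i) (j == g (m + i))%:R.
pose N' : 'M[F]_(m' - m, n) := \matrix_(i, j) (g (m + i) == j)%:R.
pose M' : 'M[F]_(n, m' - m) := \matrix_(j, i) (a (m + i) *+ (j == f (m + i))).
have AE : A = M' *m N'.
  apply/matrixP=> i j; rewrite /A -[X in index_iota X _]add0n big_addn big_mkord summxE mxE.
  apply: eq_bigr => p _; rewrite !mxE addnC.
  by rewrite mulr_natr -mulnb mulrnA mulr_natr [g _ == _]eq_sym.
have MAN : M *m A *m N = 1%:M.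
  have MM' : M *m M' = 1%:M.
    apply/matrixP=> i j; rewrite !mxE (bigD1 (f (m + i))) //= big1 => [|l /negPf li].
      rewrite !mxE eqxx addr0; case: eqP => [/f_inj e|].
        have /eqP : (m + i = m + j)%N by apply: e.
        rewrite eqn_add2l => /eqP/val_inj <-; rewrite eqxx mulr1n mulVf // a0 //.
      by case: eqVneq => [->|]; rewrite ?mulr0.
    by rewrite !mxE eq_sym li mul0r.
  have NN' : N' *m N = 1%:M.
    apply/matrixP=> i j; rewrite !mxE (bigD1 (g (m + i))) //= big1 => [|l /negPf li].
      rewrite !mxE eqxx addr0 mul1r; case: eqP => [/g_inj e|].
        have /eqP : (m + i = m + j)%N by apply: e.
        by rewrite eqn_add2l => /eqP/val_inj ->; rewrite eqxx.
      by case: eqVneq => [->|].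
    by rewrite !mxE eq_sym li mul0r.
  by rewrite AE !mulmxA MM' mul1mx NN'.
apply/eqP; rewrite eqn_leq (mulmx1_min_rank MAN) andbT AE.
exact: mulmx_max_rank.
Qed.

End DeltaSums.

Lemma big_double (V : nmodType) (G : nat -> V) s :
  \sum_(0 <= k < s.*2) G k = \sum_(0 <= p < s) (G p.*2 + G p.*2.+1).
Proof.
elim: s => [|s IHs]; first by rewrite !big_geq.
by rewrite doubleS !big_nat_recr //= IHs addrA.
Qed.

(** * The matrix of [x], its partner [Y], and their traces *)

Section OddElement.
Variables (F : numClosedFieldType) (n r s : nat) (idx : nat -> 'I_n).
Variables a c : nat -> F.
Hypothesis idx_inj :
  forall i j, (i < r)%N -> (j < r)%N -> idx i = idx j -> i = j.
Hypothesis sr : (s.*2 <= r)%N.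
Hypothesis a0 : forall p, (p < s)%N -> a p != 0.
Hypothesis c0 : forall j, (s.*2 <= j < r)%N -> c j != 0.

Local Notation D i j := (delta_mx (idx i) (idx j) : 'M[F]_n).

Definition nil_mx : 'M[F]_n := \sum_(0 <= p < s) a p *: D p.*2 p.*2.+1.
Definition ss_mx : 'M[F]_n := \sum_(s.*2 <= j < r) c j *: D j j.
Definition nil_inv : 'M[F]_n := \sum_(0 <= p < s) (a p)^-1 *: D p.*2.+1 p.*2.
Definition ss_inv : 'M[F]_n := \sum_(s.*2 <= j < r) (2 * c j)^-1 *: D j j.

Local Notation N := nil_mx.
Local Notation S := ss_mx.
Local Notation N' := nil_inv.
Local Notation S' := ss_inv.

Let idx_neq i j : (i < r)%N -> (j < r)%N -> i != j -> idx i <> idx j.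
Proof. by move=> hi hj /eqP ne /(idx_inj hi hj). Qed.

Ltac ortho := apply: mul_sum_delta0 => p q hp hq; apply: idx_neq; lia.

Lemma ss_nil : S *m N = 0. Proof. ortho. Qed.

Lemma nil_ss : N *m S = 0. Proof. ortho. Qed.

Lemma ss_nil_inv : S *m N' = 0. Proof. ortho. Qed.

Lemma nil_inv_ss : N' *m S = 0. Proof. ortho. Qed.

Lemma ss_inv_nil : S' *m N = 0. Proof. ortho. Qed.

Lemma nil_ss_inv : N *m S' = 0. Proof. ortho. Qed.

Lemma ss_inv_nil_inv : S' *m N' = 0. Proof. ortho. Qed.

Lemma nil_inv_ss_inv : N' *m S' = 0. Proof. ortho. Qed.

Lemma nil_sq : N *m N = 0. Proof. ortho. Qed.

Lemma nil_inv_sq : N' *m N' = 0. Proof. ortho. Qed.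

Ltac diagonal := apply: mul_sum_delta => // ? ? ? ? ?;
  match goal with e : idx _ = idx _ |- _ => first
    [ by apply: idx_inj e; lia
    | by apply: double_inj; apply: idx_inj e; lia
    | by apply: double_inj; apply: succn_inj; apply: idx_inj e; lia ] end.

Lemma nil_mul_inv : N *m N' = \sum_(0 <= p < s) (a p / a p) *: D p.*2 p.*2.
Proof. diagonal. Qed.

Lemma nil_inv_mul : N' *m N = \sum_(0 <= p < s) ((a p)^-1 * a p) *: D p.*2.+1 p.*2.+1.
Proof. diagonal. Qed.

Lemma mul_diag_sums (b d : nat -> F) :
  (\sum_(s.*2 <= j < r) b j *: D j j) *m (\sum_(s.*2 <= j < r) d j *: D j j)
  = \sum_(s.*2 <= j < r) (b j * d j) *: D j j.
Proof. diagonal. Qed.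

(** [N N'] and [N' N] are the idempotents of the even and the odd positions below [2 s]. [S S'] and
    [S' S] are each half the idempotent of the remaining positions, which is why [ss_inv] contains a
    2. *)
Lemma odd_mx_inv : (N + S) *m (N' + S') + (N' + S') *m (N + S)
  = \sum_(0 <= k < r) D k k.
Proof.
rewrite !(mulmxDl, mulmxDr) nil_ss_inv ss_nil_inv nil_inv_ss ss_inv_nil.
rewrite !addr0 !add0r nil_mul_inv nil_inv_mul !mul_diag_sums addrACA -!big_split /=.
rewrite [RHS](@big_cat_nat _ _ _ s.*2) //= big_double; congr (_ + _).
  by apply: eq_big_nat => p hp; rewrite divff ?mulVf ?a0 // !scale1r.
apply: eq_big_nat => j hj; rewrite -scalerDl -[RHS]scale1r; congr (_ *: _).
by field; exact: c0.
Qed.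

Lemma rank_nil_mx : \rank N = s.
Proof.
rewrite -[RHS]subn0; apply: rank_sum_delta => p; first exact: a0.
  by move=> q hp hq e; apply: double_inj; apply: idx_inj e; lia.
by move=> q hp hq e; apply: double_inj; apply: succn_inj; apply: idx_inj e; lia.
Qed.

Lemma rank_ss_mx : \rank S = (r - s.*2)%N.
Proof.
by apply: rank_sum_delta => // p q hp hq e; apply: idx_inj e; lia.
Qed.

Lemma ss_mx_diag : exists d, S = diag_mx d.
Proof.
exists (\sum_(s.*2 <= j < r) c j *: delta_mx 0 (idx j)).
rewrite linear_sum; apply: eq_bigr => j _; rewrite linearZ /=; congr (_ *: _).
apply/matrixP=> i k; rewrite !mxE; case: (eqVneq i k) => [->|ne].
  by rewrite andbb.
rewrite mulr0n; case: eqP => //= ei; case: eqP => // ek.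
by rewrite ei ek eqxx in ne.
Qed.

Lemma jordan_chevalley_odd_mx : jordan_chevalley (N + S) S N.
Proof.
split; first exact: addrC.
- by have [d ->] := ss_mx_diag; apply: diagonalizable_diag.
- by exists 2; rewrite expr2; apply: nil_sq.
- by rewrite ss_nil nil_ss.
Qed.

(** The basis vector at [idx j] is an eigenvector with eigenvalue [c j], which is non-zero.
    Nilpotency therefore forces the range of the semisimple part to be empty. *)
Lemma odd_mx_not_nilpotent k :
  (N + S) ^+ k = 0 -> forall j, (s.*2 <= j < r)%N -> False.
Proof.
move=> X0 j hj; have SD : (N + S) *m D j j = c j *: D j j.
  have -> : D j j = \sum_(j <= i < j.+1) 1 *: D i i by rewrite big_nat1 scale1r.
  rewrite mulmxDl [X in X + _]mul_sum_delta0 ?add0r; last first.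
    by move=> p q hp hq; apply: idx_neq; lia.
  rewrite big_nat1 scale1r /ss_mx mulmx_suml (bigD1_seq j) ?mem_index_iota ?iota_uniq //=.
  rewrite -scalemxAl mul_delta_mx big_nat_cond big1 ?addr0 // => i /andP[hi ij].
  rewrite -scalemxAl mul_delta_mx_cond; case: eqP => [e|]; last by rewrite scaler0.
  by case: (@idx_neq i j) => //; lia.
have: (N + S) ^+ k *m D j j = c j ^+ k *: D j j.
  elim: k {X0} => [|k IHk]; first by rewrite !expr0 scale1r mul1mx.
  rewrite exprSr -[_ * _]/(_ *m _) -mulmxA SD -scalemxAr IHk scalerA.
  by rewrite exprS.
rewrite X0 mul0mx => /matrixP/(_ (idx j) (idx j)); rewrite !mxE !eqxx mulr1.
by move/eqP; rewrite eq_sym expf_eq0 (negPf (c0 hj)) andbF.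
Qed.

Lemma tr_inv : \tr (N' + S') = 2^-1 * \sum_(s.*2 <= j < r) (c j)^-1.
Proof.
rewrite linearD !linear_sum big_nat big1 ?add0r /= => [|p hp]; last first.
  rewrite linearZ /= mxtrace_delta; case: eqP => [e|]; last by rewrite mulr0.
  by case: (@idx_neq p.*2.+1 p.*2) => //; lia.
rewrite mulr_sumr; apply: eq_bigr => j _.
by rewrite linearZ /= mxtrace_delta eqxx mulr1 invfM.
Qed.

(** [N'] squares to zero and is orthogonal to [S'], so only the cube of the diagonal part survives;
    8 is the cube of the 2 in [ss_inv]. *)
Lemma tr_inv_cube : \tr ((N' + S') *m (N' + S') *m (N' + S'))
  = 8^-1 * \sum_(s.*2 <= j < r) (c j) ^- 3.
Proof.
have -> : (N' + S') *m (N' + S') = S' *m S'.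
  by rewrite !(mulmxDl, mulmxDr) nil_inv_sq nil_inv_ss_inv ss_inv_nil_inv !add0r.
rewrite mulmxDr -(mulmxA _ _ N') ss_inv_nil_inv mulmx0 add0r !mul_diag_sums.
rewrite linear_sum mulr_sumr; apply: eq_big_nat => j hj.
rewrite linearZ /= mxtrace_delta eqxx mulr1.
by field; exact: c0.
Qed.

Section Support.
Variable J : {set 'I_n}.
Hypothesis JE : J = [set idx k | k : 'I_r].

Let idxJ k : (k < r)%N -> idx k \in J.
Proof. by move=> hk; rewrite JE; apply/imsetP; exists (Ordinal hk). Qed.

Lemma idK_support : idK F J = \sum_(0 <= k < r) D k k.
Proof.
rewrite /idK JE big_imset /= ?big_mkord //.
by move=> i j _ _ /idx_inj e; apply: val_inj; apply: e.
Qed.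

Lemma odd_mx_inv_idK :
  (N + S) *m (N' + S') + (N' + S') *m (N + S) = 1%:M - idK F (~: J).
Proof. by rewrite odd_mx_inv idKC subKr idK_support. Qed.

Lemma idKC_sum_delta (b : nat -> F) (f g : nat -> nat) m m' :
  (forall p, (m <= p < m')%N -> (f p < r)%N /\ (g p < r)%N) ->
  idK F (~: J) *m (\sum_(m <= p < m') b p *: D (f p) (g p)) = 0
  /\ (\sum_(m <= p < m') b p *: D (f p) (g p)) *m idK F (~: J) = 0.
Proof.
move=> fg; rewrite mulmx_sumr mulmx_suml !big_nat !big1 // => p hp;
  have [hf hg] := fg p hp; have [e1 e2] := idK_mul F (idxJ hf) (idxJ hg).
  by rewrite -scalemxAl idKC mulmxBr mulmx1 e2 subrr scaler0.
by rewrite -scalemxAr idKC mulmxBl mul1mx e1 subrr scaler0.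
Qed.

Lemma idKC_odd_mx :
  idK F (~: J) *m (N + S) = 0 /\ (N + S) *m idK F (~: J) = 0.
Proof.
have [p1 p2] : idK F (~: J) *m N = 0 /\ N *m idK F (~: J) = 0.
  by apply: idKC_sum_delta => p hp; lia.
have [p3 p4] : idK F (~: J) *m S = 0 /\ S *m idK F (~: J) = 0.
  by apply: idKC_sum_delta => p hp; lia.
by rewrite mulmxDl mulmxDr p1 p2 p3 p4 addr0.
Qed.

End Support.
End OddElement.

(** * Semisimplicity of [x] and assembly of the statements *)

(** [[x, x]] is [T (2 X^2) 0] with [X^2] diagonal, so its adjoint action has the matrix units
    [E_ij], even and odd, as eigenvectors, with differences of diagonal entries as eigenvalues. *)
Lemma odd_semisimple_diag (F : numClosedFieldType) (n : nat)
    (x : odd_part (q F n)) (X : 'M[F]_n) (d : 'rV[F]_n) :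
  vsval x = T 0 X -> X *m X = diag_mx d -> odd_semisimple x.
Proof.
move=> xE XX; rewrite /odd_semisimple xE T_br !(mul0mx, mulmx0) !subrr add0r addr0.
rewrite XX -linearD /=; set d2 := d + d.
apply: (lsemisimple_span (X := qK_gens F setT)).
  apply/eqP; rewrite eqEsubv subvf; apply/subvP=> u _.
  have id1 : idK F [set: 'I_n] = 1%:M by rewrite -setC0 idKC idK0 subr0.
  have := trunc_in setT u; rewrite truncE id1 !mul1mx !mulmx1 -T_surj.
  by [].
have dl i j : diag_mx d2 *m delta_mx i j = d2 0 i *: delta_mx i j.
  apply/matrixP=> k l; rewrite mul_diag_mx !mxE.
  by case: (eqVneq k i) => [->|_]; rewrite // !mulr0.
have dr i j : delta_mx i j *m diag_mx d2 = d2 0 j *: delta_mx i j.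
  apply/matrixP=> k l; rewrite mul_mx_diag !mxE mulrC.
  by case: (eqVneq l j) => [->|_]; rewrite // andbF !mulr0.
move=> v /qK_gensP[i [j [b [_ _ ->]]]]; exists (d2 0 i - d2 0 j).
rewrite (linfun_funE (br_linr _)).
by case: b; rewrite T_br !(mul0mx, mulmx0) ?subrr ?addr0 ?add0r dl dr -scalerBl
  -T_scale scaler0.
Qed.

(* Indices are zero-based: [J = {idx 0, ..., idx (r - 1)}], the nilpotent part
   uses the pairs [(idx (2 p), idx (2 p + 1))] for [p < s], and [c j] is used
   for [2 s <= j < r]. *)
Theorem proposition3p2 (R : realType) (n r s : nat) (J : {set 'I_n})
    (idx : nat -> 'I_n) (c : nat -> R[i]) (xp : nat -> q R[i] n)
    (x : odd_part (q R[i] n))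
    (hn : (0 < n)%N)
    (hJ : J = [set idx k | k : 'I_r]) (hr : #|J| = r)
    (hs : (s.*2 <= r)%N)
    (hxp : forall p, (p < s)%N ->
       exists2 a : R[i], a != 0
         & xp p = a *: T 0 (delta_mx (idx p.*2) (idx p.*2.+1)))
    (hc : forall j, (s.*2 <= j < r)%N -> c j != 0)
    (hx : vsval x = \sum_(0 <= p < s) xp p
                    + \sum_(s.*2 <= j < r) c j *: H R[i] (idx j)) :
  (odd_semisimple x /\ has_rank x (r%:R / 2)
   /\ is_nil_part x (\sum_(0 <= p < s) xp p))
  /\
  (* (i) *)
  (DS_complement x (adj (q R[i] n)) (qK_sub R[i] (~: J))
   /\ forall e : 'I_(n - r) -> 'I_n,
        injective e -> (forall k, (k \in codom e) = (k \notin J)) ->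
        lie_iso (qK_incl R[i] e (~: J)))
  /\
  (* (ii) *)
  (forall e : 'I_(n - r) -> 'I_n,
     injective e -> (forall k, (k \in codom e) = (k \notin J)) ->
     exists phi : 'Hom(stdMod R[i] (n - r), DSmod x (stdMod R[i] n)),
       [/\ bijective phi,
           forall b v, v \in par b -> phi v \in par b
         & forall (a : q R[i] (n - r)) (v : stdMod R[i] (n - r)),
             phi (act a v)
             = act (DSlie_proj x (adj (q R[i] n)) (q_incl e a)) (phi v)])
  /\
  (* (iii) *)
  ((r < n)%N ->
   [/\ DS_complement x (sq R[i] n)
         (qproj (sq_sub R[i] n) 0 @: sqK_sub R[i] (~: J))%VS,
       DS_canonical_iso x (pq R[i] n) (qK_sub R[i] (~: J)) (pqK R[i] (~: J))
         (qproj (qK_sub R[i] (~: J)) (qK_center R[i] (~: J)))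
         (qproj fullv (q_center R[i] n))
     & DS_canonical_iso x (psq R[i] n) (sqK_sub R[i] (~: J)) (psqK R[i] (~: J))
         (qproj (sqK_sub R[i] (~: J)) (qK_center R[i] (~: J)))
         (qproj (sq_sub R[i] n) (q_center R[i] n))])
  /\
  (* (iv) *)
  (r = n ->
   lie_isomorphic (DSlie x (sq R[i] n)) (abelianLie (line R[i]))
   /\ lie_isomorphic (DSlie x (pq R[i] n))
        (abelianLie (parity_change (line R[i]))))
  /\
  (* (v) *)
  (r = n -> (1 < n)%N ->
   [/\ is_nil_part x (vsval x)
       \/ (\sum_(s.*2 <= j < n) (c j)^-1 = 0
           /\ \sum_(s.*2 <= j < n) (c j) ^- 3 = 0) ->
       has_sdim (DSlie x (psq R[i] n)) 1 1
       /\ commutative_lie (DSlie x (psq R[i] n)),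
       \sum_(s.*2 <= j < n) (c j)^-1 = 0 ->
       \sum_(s.*2 <= j < n) (c j) ^- 3 != 0 ->
       lie_isomorphic (DSlie x (psq R[i] n)) (q R[i] 1)
     & \sum_(s.*2 <= j < n) (c j)^-1 != 0 ->
       forall u : DSlie x (psq R[i] n), u = 0]).
Proof.
(* The scalar of each nilpotent summand is recovered as a matrix entry, which gives one function [a]
   without choosing among the witnesses of [hxp]. *)
pose a p := oddpart (xp p) (idx p.*2) (idx p.*2.+1).
have [a0 xpE] : (forall p, (p < s)%N -> a p != 0) /\ forall p, (p < s)%N ->
    xp p = T 0 (a p *: delta_mx (idx p.*2) (idx p.*2.+1)).
  have h p : (p < s)%N -> a p != 0
      /\ xp p = T 0 (a p *: delta_mx (idx p.*2) (idx p.*2.+1)).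
    move=> /hxp[k k0 e]; rewrite /a e oddpartZ oddpart_T !mxE !eqxx mulr1.
    by rewrite -T_scale scaler0.
  by split=> p /h[].
have idx_inj i j : (i < r)%N -> (j < r)%N -> idx i = idx j -> i = j.
  move=> hi hj e; have /imset_injP inj : #|[set idx k | k : 'I_r]| == #|'I_r|.
    by rewrite -hJ hr card_ord.
  by have /(congr1 val) := inj (Ordinal hi) (Ordinal hj) isT isT e.
pose N := nil_mx s idx a; pose S := ss_mx r s idx c.
pose Y := nil_inv s idx a + ss_inv r s idx c.
have T_sum (I : Type) (l : seq I) (G : I -> 'M[R[i]]_n) :
    T 0 (\sum_(i <- l) G i) = \sum_(i <- l) T 0 (G i).
  by apply: (big_morph _ _ (T0 _ _)) => u v; apply: T_addr.
have NE : \sum_(0 <= p < s) xp p = T 0 N.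
  by rewrite T_sum; apply: eq_big_nat => p hp; rewrite xpE.
have xE : vsval x = T 0 (N + S).
  rewrite hx NE T_addr; congr (_ + _); rewrite T_sum; apply: eq_bigr => j _.
  by rewrite -T_scale scaler0.
have JC : jordan_chevalley (oddpart (vsval x)) S N.
  by rewrite xE oddpart_T; apply: jordan_chevalley_odd_mx.
have XY := odd_mx_inv_idK idx_inj hs a0 hc hJ.
have [PX XP] := idKC_odd_mx a c hs hJ.
have trY := tr_inv a c idx_inj hs; have trY3 := tr_inv_cube a idx_inj hs hc.
split.
  split; last split; last by exists S, N; rewrite NE.
    have [d Sd] := ss_mx_diag r s idx c.
    (* [N^2], [N S] and [S N] vanish, so [X^2 = S^2] is diagonal. *)
    apply: (odd_semisimple_diag (d := \row_i (d 0 i * d 0 i)) xE).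
    rewrite !(mulmxDl, mulmxDr) (nil_sq a idx_inj) // (nil_ss a c idx_inj) //.
    rewrite (ss_nil a c idx_inj) // !add0r /S Sd mulmx_diag.
    by congr diag_mx; apply/rowP=> i; rewrite !mxE.
  (* The ranks [s] and [r - 2 s] give [s + (r - 2 s) / 2 = r / 2]. *)
  exists S, N; split=> //; rewrite (rank_nil_mx idx_inj hs a0).
  rewrite (rank_ss_mx idx_inj hs hc) natrB // -mul2n natrM.
  by field.
split.
  split; first exact: DS_complement_q xE PX XP XY.
  move=> e e_inj e_J; apply: lie_iso_qK_incl => // k.
  by rewrite inE -e_J.
split.
  move=> e e_inj e_J; apply: (DS_std_iso xE PX XP XY e_inj) => k.
  by rewrite inE -e_J.
split.
  move=> rn; have [k0 Kk0] : exists k, k \in ~: J.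
    by apply/set0Pn; rewrite -card_gt0 cardsCs setCK card_ord hr subn_gt0.
  split; [exact: (DS_complement_sq xE PX XP XY Kk0) | exact: (DS_canonical_iso_pq xE PX XP XY Kk0)
    | exact: (DS_canonical_iso_psq xE PX XP XY Kk0)].
have full : r = n -> (N + S) *m Y + Y *m (N + S) = 1%:M.
  move=> rn; have JT : J = setT.
    by apply/eqP; rewrite eqEcard subsetT cardsT card_ord hr rn leqnn.
  by rewrite XY JT setCT idK0 subr0.
split=> [/full XY1 | rn n1].
  by split; [exact: (DS_sq_full hn xE XY1) | exact: (DS_pq_full hn xE XY1)].
have XY1 := full rn; rewrite -[in X in index_iota _ X]rn.
have half0 : 2^-1 != 0 :> R[i] by rewrite invr_neq0 // pnatr_eq0.
have eighth0 : 8^-1 != 0 :> R[i] by rewrite invr_neq0 // pnatr_eq0.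
split=> [h | c1 c3 | c1].
- have [c1 c3] : \sum_(s.*2 <= j < r) (c j)^-1 = 0
      /\ \sum_(s.*2 <= j < r) (c j) ^- 3 = 0.
    (* Whichever decomposition witnesses that [x] is its own nilpotent part, its nilpotent term
       equals [N + S]. No index is then left for the sums, and both are empty. *)
    case: h => [[Bss [Bnil [[_ _ [k nilB] _] xB]]] | //].
    have eB : Bnil = N + S.
      by have := congr1 (@oddpart _ _) xB; rewrite xE !oddpart_T.
    rewrite eB in nilB; have none := odd_mx_not_nilpotent idx_inj hs hc nilB.
    by split; rewrite big_nat big1 // => j /none.
  by apply: (DS_psq_commutative hn xE XY1); rewrite ?trY ?trY3 ?c1 ?c3 mulr0.
- apply: (DS_psq_q1 hn xE XY1); first by rewrite trY c1 mulr0.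
  by rewrite trY3 mulf_neq0.
- by apply: (DS_psq_full0 hn xE XY1); rewrite trY mulf_neq0.
Qed.
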